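(* Consider a 1-D SCS with BS density function $\lambda(r)$, path-loss model $\frac1R$, and random transmission power $K$ and random fading $\Psi$ which are i.i.d. across all BSs, with arbitrary joint distribution of $(K,\Psi)$. Suppose $$\bar\lambda(r)=\mathbb{E}_{K,\Psi}\left[K\Psi\,\lambda(K\Psi r)\right]<\infty\quad\text{for all } r\ge0.$$ Then this SCS is equivalent to the 1-D SCS with BS density function $\bar\lambda(r)$, path-loss model $\frac1R$, unity transmission power and unity fading. In particular, the distributions of the SINRs at the MSs located at the origin of the two SCSs are the same if the noise powers of the MSs are equal.
   Context: A 1-D SCS (shotgun cellular system) with one-sided BS density function $\lambda(r)$, $r\ge 0$, has base stations (BSs) at the points $R_j$ of a Poisson point process on $[0,\infty)$ with (locally integrable) intensity $\lambda$. The mobile station (MS) is at the origin. With path-loss model $1/R$, the BS at distance $R_j$ is received with power $K_j\Psi_j/R_j$, where the pairs $(K_j,\Psi_j)$ of nonnegative random variables (transmission power, fading factor) are i.i.d. copies of $(K,\Psi)$, independent of the BS locations. The serving BS is the one with the strongest received power. The SINR is the received power of the serving BS divided by the sum of the received powers of all other BSs plus the constant noise power $\eta\ge0$. Two SCSs are equivalent if the joint distribution of the powers received at the MS at the origin from all the BSs is the same in both systems (i.e. the random collections, counted with multiplicity, of nonzero received powers have the same law). *)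

(* Defs.v *)
From HB Require Import structures.
From mathcomp Require Export all_boot all_order all_algebra.
From mathcomp Require Export finmap.
From mathcomp Require Export all_classical all_reals all_analysis.
From mathcomp Require Export measurable_realfun.

Set Implicit Arguments.
Unset Strict Implicit.
Unset Printing Implicit Defensive.

Import Order.TTheory GRing.Theory Num.Theory.
Import numFieldNormedType.Exports.

Local Open Scope classical_set_scope.
Local Open Scope ring_scope.
Local Open Scope ereal_scope.

Section independence.
Context {d} {T : measurableType d} {R : realType} (P : probability T R).

Definition mutually_independent {I : choiceType}
    (F : I -> set_system T) : Prop :=
  forall (J : {fset I}) (E : I -> set T),
    (forall i, i \in J -> F i (E i)) ->
    P (\bigcap_(i in [set` J]) E i) = \prod_(i <- J) P (E i).

Definition independent2 (F G : set_system T) : Prop :=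
  forall A B, F A -> G B -> P (A `&` B) = P A * P B.

Definition sigma_process {d'} {T' : measurableType d'} (X : nat -> T -> T') :
    set_system T :=
  <<s \bigcup_j g_sigma_algebra_preimage (X j) >>.

End independence.

(* Number of points, counted with multiplicity, that the indexed collection [x]
   has in [A]. *)
Definition point_count {R : realType} (x : nat -> \bar R) (A : set (\bar R)) :
    \bar R :=
  counting (x @^-1` A).

Section poisson_process.
Context {d} {T : measurableType d} {R : realType} (P : probability T R).

(* The library's [poisson_pmf] is not used because [poisson_pmf 0 n = 1] for all
   n.  A Poisson variable of infinite mean is almost surely infinite. *)
Definition poisson_distributed (m : \bar R) (N : T -> \bar R) : Prop :=
  match m with
  | r%:E => forall n : nat,
      P [set w | N w = n%:R%:E] = (expR (- r) * r ^+ n / n`!%:R)%R%:E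
  | _ => P [set w | N w = +oo] = 1
  end.

(* The points of a Poisson process on [0, +oo[ are listed as X 0, X 1, ...; the
   value +oo means that the list has no point at that index, so that the number
   of points may be finite.  The intensity need not be locally integrable. *)
Record poisson_point_process (lambda : R -> R) (X : nat -> T -> \bar R) :
    Prop := {
  ppp_measurable : forall j, measurable_fun setT (X j) ;
  ppp_ge0 : forall j w, 0 <= X j w ;
  ppp_poisson : forall A : set R, measurable A -> A `<=` `[0%R, +oo[ ->
    poisson_distributed (\int[lebesgue_measure]_(r in A) (lambda r)%:E)
      (fun w => point_count (X ^~ w) (EFin @` A)) ;
  ppp_independent : forall A : nat -> set R,
    (forall i, measurable (A i)) -> (forall i, A i `<=` `[0%R, +oo[) ->
    trivIset setT A ->
    mutually_independent P
      (fun i => g_sigma_algebra_preimage (fun w => point_count (X ^~ w) (EFin @` A i)))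
}.

End poisson_process.

Definition bs_density {R : realType} (lambda : R -> R) : Prop :=
  [/\ measurable_fun (`[0%R, +oo[ : set R) lambda,
      forall r : R, (0 <= r)%R -> (0 <= lambda r)%R &
      forall t : R, \int[lebesgue_measure]_(r in `[0%R, t]) (lambda r)%:E < +oo].

Section scs.
Context {d} {T : measurableType d} {R : realType} (P : probability T R).
Context {d'} {S : measurableType d'} (Q : probability S R).

(* One-dimensional shotgun cellular system realised on (T, P): the j-th base
   station is at distance [D j] (+oo if there is none) and has transmission
   power [Kj j] and fading [Psij j]; the pairs are i.i.d. copies of the pair
   (K, Psi) given on (S, Q). *)
Record is_scs (lambda : R -> R) (K Psi : S -> R)
    (D : nat -> T -> \bar R) (Kj Psij : nat -> T -> R) : Prop := {
  scs_locations : poisson_point_process P lambda D ;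
  scs_power_measurable : forall j, measurable_fun setT (Kj j) ;
  scs_fading_measurable : forall j, measurable_fun setT (Psij j) ;
  scs_power_ge0 : forall j w, (0 <= Kj j w)%R ;
  scs_fading_ge0 : forall j w, (0 <= Psij j w)%R ;
  scs_identically_distributed : forall j (B : set (R * R)), measurable B ->
    P [set w | B (Kj j w, Psij j w)] = Q [set s | B (K s, Psi s)] ;
  scs_marks_independent :
    mutually_independent P (fun j => g_sigma_algebra_preimage (fun w => (Kj j w, Psij j w))) ;
  scs_marks_locations_independent :
    independent2 P (sigma_process D)
      (sigma_process (fun j w => (Kj j w, Psij j w)))
}.

Definition lambda_bar (K Psi : S -> R) (lambda : R -> R) (r : R) : \bar R :=
  'E_Q[fun s => (K s * Psi s * lambda (K s * Psi s * r))%R].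

End scs.

(* Extended-real division has x / +oo = 0, so an index without base station
   yields the power 0. *)
Definition received_power {T : Type} {R : realType} (D : nat -> T -> \bar R)
    (Kj Psij : nat -> T -> R) (w : T) (j : nat) : \bar R :=
  (Kj j w * Psij j w)%:E / D j w.

(* Generators of the sigma-algebra on point configurations, a configuration
   being identified with its counting function; sets containing 0 are left out
   so that only nonzero powers are observed. *)
Definition configuration_cylinders {R : realType} :
    set_system (set (\bar R) -> \bar R) :=
  [set E | exists A B : set (\bar R), [/\ measurable A, ~ A 0, measurable B &
             E = [set m | B (m A)]]].

Section comparison.
Context {R : realType}.
Context {d1} {T1 : measurableType d1} (P1 : probability T1 R).
Context {d2} {T2 : measurableType d2} (P2 : probability T2 R).

Definition scs_equivalent (p1 : T1 -> nat -> \bar R) (p2 : T2 -> nat -> \bar R) :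
    Prop :=
  forall E, <<s configuration_cylinders >> E ->
    P1 [set w | E (point_count (p1 w))] = P2 [set w | E (point_count (p2 w))].

Definition same_distribution (X1 : T1 -> \bar R) (X2 : T2 -> \bar R) : Prop :=
  forall B : set (\bar R), measurable B ->
    P1 (X1 @^-1` B) = P2 (X2 @^-1` B).

End comparison.

Section sinr.
Context {R : realType}.

Definition is_serving (p : nat -> \bar R) (j : nat) : Prop :=
  forall i, p i <= p j.

(* The SINR is set to 0 when no received power is the strongest.  Here
   x / 0 = +oo for x > 0 and 0 / 0 = 0; in particular the value is 0 when every
   power is 0.  Ties do not affect the value. *)
Definition sinr (eta : R) (p : nat -> \bar R) : \bar R :=
  if `[< exists j, is_serving p j >] then
    let j0 := get (is_serving p) in
    p j0 / (\sum_(i <oo | i != j0) p i + eta%:E)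
  else 0.

End sinr.

(* Main.v *)
(* Both systems are compared through the functional E \prod_j phi(p_j) of the
   received powers p_j, for measurable phi with values in [0, 1] and phi(0) = 1.
   Given the locations D_j, the marks are i.i.d., so the functional equals
   E \prod_j h(D_j) with h(r) = E phi(K Psi / r), which for a Poisson process of
   intensity lambda is exp(- \int (1 - h(r)) lambda(r) dr).  By Tonelli and the
   substitution r = K Psi s, the exponent is \int (1 - phi(1/s)) lambda_bar(s) ds,
   the one of the second system.  Taking phi = 2 ^ (- \sum_i k_i 1_{A_i}) gives
   the mixed moments of the variables 2 ^ (- N(A_i)), where N(A) is the number of
   powers in A; these determine the joint law of the counts, even when the
   intensity is not locally integrable and counts are infinite.  Finally the SINR
   is a measurable function of the configuration of the powers. *)

From HB Require Import structures.
Require Import Defs.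
From mathcomp Require Import all_boot all_order all_algebra.
From mathcomp Require Import all_classical all_reals all_analysis.
From mathcomp Require Import ring lra zify.

Set Implicit Arguments.
Unset Strict Implicit.
Unset Printing Implicit Defensive.

Import Order.TTheory GRing.Theory Num.Theory.
Import numFieldNormedType.Exports.

Local Open Scope classical_set_scope.
Local Open Scope ring_scope.
Local Open Scope ereal_scope.
Import HBNNSimple.

(** The list of points comes in an order that may depend on the whole configuration, so no law of a
    single location is available: the hypotheses speak only of counts in disjoint sets. The
    functional is therefore computed first for [1 - s] with [s] simple, where it is a finite product
    of generating functions of independent counts. It is always read as a limit over the first J
    indices, whose value does not depend on the order. Finiteness of [lambda_bar] at each point does
    not bound its integral over bounded intervals. Exponents are thus extended reals, and counts
    enter only through powers of a base [c < 1]: the convention [c ^ +oo = 0] then agrees with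
    [exp(- oo) = 0], the value for an infinite mean. Stations with [K Psi = 0] and indices without a
    station both have power 0. Taking [phi(0) = 1], and sets that avoid 0, makes them invisible. The
    interference cannot be recovered as the total power minus the strongest one, as both may be
    infinite. It is obtained from simple approximations of the powers, for which the subtracted term
    is finite. *)

(** * Integrals of products of independent variables *)

Section independence_lemmas.
Context {d} {T : measurableType d} {R : realType} (P : probability T R).

(** Passage from indicators to simple functions, then to monotone limits. The constant [c] is left
    abstract because it will be a product of integrals and probabilities of other variables; its
    finiteness lets it pass through the limit. *)
Lemma ge0_integralM_of_preimage {d'} {T' : measurableType d'} (U : T -> R)
    (Y : T -> T') (f : T' -> R) (c : \bar R) :
  measurable_fun setT U -> (forall w, 0 <= U w)%R ->
  measurable_fun setT Y -> measurable_fun setT f -> (forall y, 0 <= f y)%R ->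
  c \is a fin_num ->
  (forall B, measurable B ->
     \int[P]_w (U w * \1_(Y @^-1` B) w)%:E = c * P (Y @^-1` B)) ->
  \int[P]_w (U w * f (Y w))%:E = c * \int[P]_w (f (Y w))%:E.
Proof.
move=> mU U0 mY mf f0 cfin UB.
have mf' : measurable_fun setT (EFin \o f) by exact/measurable_EFinP.
pose f_ := nnsfun_approx (@measurableT _ T') mf'.
have mYB B : measurable B -> measurable (Y @^-1` B).
  by move=> mB; rewrite -[X in measurable X]setTI; exact: mY.
have mfr n r : measurable (f_ n @^-1` [set r]) by exact: measurable_funPTI.
have mfY n : measurable_fun setT (fun w => f_ n (Y w)).
  by apply: measurableT_comp mY; exact: measurable_funP.
have fcvg y : (f_ n y)%:E @[n --> \oo] --> (f y)%:E.
  by apply: cvg_nnsfun_approx => // z _; rewrite lee_fin.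
have fnd y m n : (m <= n)%N -> (f_ m y <= f_ n y)%R.
  by move=> mn; exact/lefP/nd_nnsfun_approx.
have eqn n : \int[P]_w (U w * f_ n (Y w))%:E = c * \int[P]_w (f_ n (Y w))%:E.
  pose F r w : \bar R := (r * \1_(f_ n @^-1` [set r]) (Y w))%:E.
  have mF r : measurable_fun setT (F r).
    apply/measurable_EFinP/measurable_funM => //.
    exact/measurable_indic/mYB/mfr.
  have F0 r w : 0 <= F r w by exact: nnfun_muleindic_ge0.
  have fE w : (f_ n (Y w))%:E = \sum_(r \in range (f_ n)) F r w.
    by rewrite fsumEFin// -fimfunE.
  under eq_integral do rewrite EFinM fE.
  under [in RHS]eq_integral do rewrite fE.
  under eq_integral do rewrite ge0_mule_fsumr//.
  rewrite !ge0_integral_fsum//; last 2 first.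
  - by move=> r; apply: emeasurable_funM => //; apply/measurable_EFinP.
  - by move=> r w _; rewrite mule_ge0// lee_fin.
  rewrite fsbig_finite// [in RHS]fsbig_finite//= fin_num_sume_distrr//; last first.
    by move=> i j _ _; apply: ge0_adde_def; apply: integral_ge0.
  apply: eq_bigr => r _; rewrite /F.
  (* The sum no longer records that [r] is a value of [f_ n]; a negative [r] has an empty preimage
     and gives 0 on both sides. *)
  have [r0|r0] := ltP r 0%R.
    by rewrite !integral0_eq ?mule0// => w _; rewrite preimage_nnfun0// indic0 mulr0 ?mule0.
  under eq_integral => w _.
    rewrite (_ : _ * _ = r%:E * (U w * \1_(Y @^-1` (f_ n @^-1` [set r])) w)%:E); last first.
      by rewrite -!EFinM; congr (_%:E); rewrite mulrCA.
    over.
  rewrite ge0_integralZl_EFin//; last 2 first.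
  - by move=> w _; rewrite lee_fin mulr_ge0.
  - by apply/measurable_EFinP/measurable_funM => //; exact/measurable_indic/mYB.
  rewrite UB//.
  under [in RHS]eq_integral do rewrite EFinM.
  rewrite ge0_integralZl_EFin//; last first.
    apply/measurable_EFinP.
    exact/measurable_indic/mYB/mfr.
  rewrite muleCA; congr (_ * (_ * _)).
  rewrite (_ : (fun x => _) = (fun w => (\1_(Y @^-1` (f_ n @^-1` [set r])) w)%:E))//.
  by rewrite integral_indic ?setIT//; exact: mYB.
have lhs : \int[P]_w (U w * f_ n (Y w))%:E @[n --> \oo] --> \int[P]_w (U w * f (Y w))%:E.
  rewrite (_ : \int[P]_w _ = \int[P]_w limn (fun n => (U w * f_ n (Y w))%:E)).
    apply: cvg_monotone_convergence => //.
    - by move=> n; apply/measurable_EFinP/measurable_funM.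
    - by move=> n w _; rewrite lee_fin mulr_ge0.
    - by move=> w _ m n mn; rewrite lee_fin ler_wpM2l ?fnd.
  apply: eq_integral => w _; apply/esym/cvg_lim => //.
  by rewrite EFinM; exact: (cvgeZl _ (fcvg (Y w))).
have rhs : c * \int[P]_w (f_ n (Y w))%:E @[n --> \oo] --> c * \int[P]_w (f (Y w))%:E.
  apply: cvgeZl => //.
  rewrite (_ : \int[P]_w _ = \int[P]_w limn (fun n => (f_ n (Y w))%:E)).
    apply: cvg_monotone_convergence => //.
    - by move=> n; apply/measurable_EFinP.
    - by move=> n w _; rewrite lee_fin.
    - by move=> w _ m n mn; rewrite lee_fin fnd.
  by apply: eq_integral => w _; apply/esym/cvg_lim => //.
move: lhs; under eq_fun do rewrite eqn.
by move=> lhs; exact: (cvg_unique _ lhs rhs).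
Qed.

Lemma integral_unit_le1 (U : T -> R) :
  measurable_fun setT U -> (forall w, 0 <= U w <= 1)%R ->
  \int[P]_w (U w)%:E <= 1.
Proof.
move=> mU U01; apply: (@le_trans _ _ (\int[P]_w (cst 1 w))).
  apply: ge0_le_integral => //.
  - by move=> w _; rewrite lee_fin; case/andP: (U01 w).
  - exact/measurable_EFinP.
  - by move=> w _; rewrite lee_fin; case/andP: (U01 w).
by rewrite integral_cst//= mul1e; exact: probability_le1.
Qed.

Lemma integral_unit_fin_num (U : T -> R) :
  measurable_fun setT U -> (forall w, 0 <= U w <= 1)%R ->
  \int[P]_w (U w)%:E \is a fin_num.
Proof.
move=> mU U01; rewrite ge0_fin_numE; last first.
  by apply: integral_ge0 => w _; rewrite lee_fin; case/andP: (U01 w).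
exact: le_lt_trans (integral_unit_le1 mU U01) (ltry _).
Qed.

Lemma integrable_unit (U : T -> R) :
  measurable_fun setT U -> (forall w, 0 <= U w <= 1)%R ->
  P.-integrable setT (EFin \o U).
Proof.
move=> mU U01; apply/integrableP; split; first exact/measurable_EFinP.
under eq_integral => w _.
  rewrite /= ger0_norm; last by case/andP: (U01 w).
  over.
exact: le_lt_trans (integral_unit_le1 mU U01) (ltry _).
Qed.

Lemma integral_prod_mutually_independent {d'} {T' : measurableType d'}
    {I : choiceType} (Y : I -> T -> T') (f : I -> T' -> R) (s : seq I) :
  (forall i, measurable_fun setT (Y i)) ->
  (forall i, measurable_fun setT (f i)) ->
  (forall i y, 0 <= f i y <= 1)%R ->
  mutually_independent P (fun i => g_sigma_algebra_preimage (Y i)) ->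
  uniq s ->
  \int[P]_w (\prod_(i <- s) f i (Y i w))%:E = \prod_(i <- s) \int[P]_w (f i (Y i w))%:E.
Proof.
move=> mY mf f01 indY us.
have mfY i : measurable_fun setT (fun w => f i (Y i w)).
  exact: measurableT_comp.
have mYB i B : measurable B -> measurable (Y i @^-1` B).
  by move=> mB; rewrite -[X in measurable X]setTI; exact: mY.
(* The indicators of events are replaced by the functions [f i] one at a time. *)
suff gen (t : seq I) (B : I -> set T') : (forall i, measurable (B i)) ->
    uniq (s ++ t) ->
    \int[P]_w (\prod_(i <- s) f i (Y i w) * \prod_(i <- t) \1_(Y i @^-1` B i) w)%:E
    = \prod_(i <- s) \int[P]_w (f i (Y i w))%:E * \prod_(i <- t) P (Y i @^-1` B i).
  move: (gen [::] (fun=> setT)); rewrite cats0 big_nil mule1 => <-//.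
  by apply: eq_integral => w _; rewrite big_nil mulr1.
(* [t] and [B] stay general: in the induction step the hypothesis is applied with [a] moved to the
   list of indicators. *)
elim: s {us} t B => [|a s IH] t B mB /= ust.
  rewrite big_nil mul1e.
  under eq_integral do rewrite big_nil mul1r.
  transitivity (P (\bigcap_(i in [set` [fset x in t]%fset]) (Y i @^-1` B i))).
    rewrite -[in RHS](setIT (bigcap _ _)) -integral_indic//; last first.
      by apply: fin_bigcap_measurable => // i _; exact: mYB.
    apply: eq_integral => w _; congr (_%:E).
    rewrite indicE; have [|] := boolP (w \in _).
      rewrite inE => wt; rewrite big_seq big1// => i it.
      by rewrite indicE mem_set//; apply: wt; rewrite /= !inE.
    rewrite notin_setE => nwt.
    have [i it niw] : exists2 i, i \in t & ~ B i (Y i w).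
      apply: contrapT => h; apply: nwt => i /=; rewrite !inE => it.
      by apply: contrapT => ?; apply: h; exists i.
    rewrite (big_rem i)//= indicE memNset ?mul0r//.
  rewrite indY; last by move=> i _; exists (B i) => //; rewrite setTI.
  apply: perm_big; apply: uniq_perm => //.
  by move=> i; rewrite !inE.
have uast : uniq (s ++ a :: t) by rewrite (perm_uniq (permEl (perm_catCA s [:: a] t))).
have /andP[ast _] := ust.
have /andP[_ ant] : (a \notin s) && (a \notin t) by rewrite -negb_or -mem_cat.
pose U w := (\prod_(i <- s) f i (Y i w) * \prod_(i <- t) \1_(Y i @^-1` B i) w)%R.
pose c := \prod_(i <- s) \int[P]_w (f i (Y i w))%:E * \prod_(i <- t) P (Y i @^-1` B i).
transitivity (\int[P]_w (U w * f a (Y a w))%:E).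
  by apply: eq_integral => w _; rewrite big_cons -mulrA mulrC.
rewrite (@ge0_integralM_of_preimage _ _ U (Y a) (f a) c)//.
- by rewrite big_cons muleC muleA.
- apply: measurable_funM; first by apply: measurable_prod => i _.
  by apply: measurable_prod => i _; apply: measurable_indic; exact: mYB.
- move=> w; rewrite mulr_ge0// prodr_ge0// => i _.
  by case/andP: (f01 i (Y i w)).
- by move=> y; case/andP: (f01 a y).
- apply: fin_numM; apply: prode_fin_num => i _.
    by apply: integral_unit_fin_num => // w; exact: f01.
  by apply: fin_num_measure; exact: mYB.
(* As [a] does not occur in [t], the family [B] can be changed at [a] alone to carry the arbitrary
   event [B']. *)
- move=> B' mB'; pose B2 i := if i == a then B' else B i.
  have B2t : {in t, B2 =1 B} by move=> i it; rewrite /B2; case: eqP it ant => // -> ->.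
  have B2a : B2 a = B' by rewrite /B2 eqxx.
  transitivity (\int[P]_w (\prod_(i <- s) f i (Y i w) *
      \prod_(i <- a :: t) \1_(Y i @^-1` B2 i) w)%:E).
    apply: eq_integral => w _; congr (_%:E); rewrite big_cons B2a /U -mulrA; congr (_ * _)%R.
    rewrite mulrC; congr (_ * _)%R; rewrite big_seq [RHS]big_seq; apply: eq_bigr => i it.
    by rewrite B2t.
  rewrite IH//; last by move=> i; rewrite /B2; case: ifP.
  rewrite big_cons B2a /c -muleA; congr (_ * _).
  rewrite muleC; congr (_ * _); rewrite big_seq [RHS]big_seq.
  by apply: eq_bigr => i it; rewrite B2t.
Qed.

End independence_lemmas.

(** * Counts and their bounded powers *)

Definition ext_nat {R : realType} (x : \bar R) :=
  (exists n : nat, x = n%:R%:E) \/ x = +oo.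

Section counts.
Context {R : realType}.

Lemma point_countE (x : nat -> \bar R) (A : set (\bar R)) :
  point_count x A = \sum_(n <oo) (\1_A (x n))%:E.
Proof. by rewrite /point_count counting_dirac; apply: eq_eseriesr. Qed.

Lemma point_count_nat (x : nat -> \bar R) (A : set (\bar R)) :
  ext_nat (point_count x A).
Proof. by rewrite /point_count /counting; case: ifP => _; [left; eexists|right]. Qed.

(* [c ^ N], with [c ^ +oo = 0]; it is set to 0 outside of [0, +oo[ so that it is
   bounded on the whole extended real line. *)
Definition epow (c : R) (N : \bar R) : R :=
  (\1_`[0%E, +oo%E[%classic N * c `^ fine N)%R.

Lemma epow_nat c n : (0 <= c)%R -> epow c n%:R%:E = (c ^+ n)%R.
Proof.
move=> c0; rewrite /epow indicE mem_set /= ?mul1r ?powR_mulrn//.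
by rewrite in_itv/= lee_fin ler0n ltry.
Qed.

Lemma epowy c : epow c +oo = 0%R.
Proof. by rewrite /epow indicE memNset ?mul0r//= in_itv/= ltxx andbF. Qed.

Lemma epow_itv c N : (0 <= c <= 1)%R -> (0 <= epow c N <= 1)%R.
Proof.
case/andP=> c0 c1; rewrite /epow indicE; have [|_] := boolP (N \in _); last first.
  by rewrite mul0r lexx ler01.
rewrite inE /= in_itv/= mul1r powR_ge0 => /andP[N0 _].
have := @ge0_ler_powR R (fine N) (fine_ge0 N0) c 1%R.
by rewrite powR1; apply => //; rewrite nnegrE.
Qed.

Lemma measurable_epow c : measurable_fun [set: \bar R] (epow c).
Proof.
apply: measurable_funM; first by apply: measurable_indic; exact: emeasurable_itv.
by apply: (measurableT_comp (@measurable_powRr R c)); exact: fine_measurable.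
Qed.

(** The partial product is [c] raised to the number of points among the first [J] indices. With
    infinitely many points it tends to 0 because [c < 1], in accordance with [epow c +oo = 0]. *)
Lemma cvg_prod_epow (x : nat -> \bar R) (A : set (\bar R)) c : (0 <= c < 1)%R ->
  (\prod_(j < J) (if x j \in A then c else 1))%R @[J --> \oo] --> epow c (point_count x A).
Proof.
move=> /andP[c0 c1]; pose k J := (\sum_(j < J) (x j \in A))%N.
have -> : (fun J => \prod_(j < J) (if x j \in A then c else 1))%R = (fun J => c ^+ k J)%R.
  apply/funext => J; rewrite /k; elim: J => [|J IH]; first by rewrite !big_ord0.
  by rewrite !big_ord_recr/= IH exprD; case: ifP.
have kN : (k J)%:R%:E @[J --> \oo] --> point_count x A.
  rewrite point_countE.
  rewrite (_ : (fun J => _) = (fun J => \sum_(0 <= n < J) (\1_A (x n))%:E)).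
    by apply: is_cvg_nneseries => n _ _; rewrite lee_fin.
  by apply/funext => J; rewrite big_mkord sumEFin /k natr_sum.
have [[n Nn]|Ny] := point_count_nat x A.
  rewrite Nn epow_nat// in kN *.
  (* A natural number at distance less than 1 from [n] equals [n], so the sequence is eventually
     constant. *)
  apply: cvg_near_cst; move/fine_cvgP : kN => [_] /cvgrPdist_lt /(_ 1%R ltr01).
  apply: filterS => J /=; rewrite ltr_norml => /andP[h1 h2]; congr (_ ^+ _)%R.
  have : (k J < n.+1)%N by rewrite -(ltr_nat R) -natr1; lra.
  have : (n < (k J).+1)%N by rewrite -(ltr_nat R) -natr1; lra.
  by lia.
rewrite Ny epowy; rewrite Ny in kN; move/cvgenyP in kN.
have := @cvg_expr R c; rewrite ger0_norm// => /(_ c1) cn.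
exact: (cvg_comp _ _ kN cn).
Qed.

End counts.

(** * Generating function of a Poisson count *)

Section poisson_pgf.
Context {d} {T : measurableType d} {R : realType} (P : probability T R).

Lemma measurable_point_count (X : nat -> T -> \bar R) (A : set (\bar R)) :
  (forall j, measurable_fun setT (X j)) -> measurable A ->
  measurable_fun setT (fun w => point_count (X ^~ w) A).
Proof.
move=> mX mA; under eq_fun do rewrite point_countE.
apply: ge0_emeasurable_sum => [n w _ _|n _]; first by rewrite lee_fin.
apply/measurable_EFinP; apply: (measurableT_comp _ (mX n)).
exact: measurable_indic.
Qed.

(** For a finite mean [r] this is the exponential series at [c * r]. For an infinite mean, [N] is
    almost surely +oo and both sides are 0 because [c < 1]. The value [c = 0] occurs for simple
    functions that reach 1. *)
Lemma poisson_pgf (m : \bar R) (N : T -> \bar R) (c : R) :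
  measurable_fun setT N ->
  (forall w, ext_nat (N w)) ->
  0 <= m -> (0 <= c < 1)%R -> poisson_distributed P m N ->
  \int[P]_w (epow c (N w))%:E = expeR (- ((1 - c)%:E * m)).
Proof.
move=> mN natN m0 /andP[c0 c1] PN.
have mNn (x : \bar R) : measurable [set w | N w = x].
  by have := mN measurableT [set x] (emeasurable_set1 x); rewrite setTI.
have epowE w : (epow c (N w))%:E = \sum_(n <oo) (c ^+ n * \1_[set w | N w = n%:R%:E] w)%:E.
  have [[n Nn]|Ny] := natN w; last first.
    rewrite Ny epowy eseries0// => n _ _; rewrite indicE memNset ?mulr0//=.
    by rewrite Ny.
  pose F i := (c ^+ i * \1_[set w | N w = i%:R%:E] w)%:E.
  have F0 k : xpredT k -> 0 <= F k by rewrite lee_fin mulr_ge0// exprn_ge0.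
  rewrite Nn epow_nat// [RHS](nneseriesD1 F0 (n := n))//.
  have -> : F n = (c ^+ n)%:E by rewrite /F indicE mem_set//= mulr1.
  rewrite eseries0 ?adde0// => i _ ni; rewrite /F indicE memNset ?mulr0//= Nn => -[] /eqP;
    rewrite eqr_nat => /eqP nin.
  by rewrite nin eqxx in ni.
under eq_integral do rewrite epowE.
rewrite integral_nneseries//; last 2 first.
- move=> n; apply/measurable_EFinP/measurable_funM => //; exact: measurable_indic.
- by move=> n w _; rewrite lee_fin mulr_ge0// exprn_ge0.
transitivity (\sum_(n <oo) ((c ^+ n)%:E * P [set w | N w = n%:R%:E])).
  apply: eq_eseriesr => n _; under eq_integral do rewrite EFinM.
  rewrite ge0_integralZl_EFin ?exprn_ge0//; last first.
    by apply/measurable_EFinP; exact: measurable_indic.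
  by rewrite integral_indic ?setIT//; exact: mNn.
case: m m0 PN => [r r0 PN|_ PN|//].
  transitivity (\sum_(n <oo) (expR (- r) * exp_coeff (c * r) n)%:E).
    apply: eq_eseriesr => n _; rewrite PN -EFinM; congr (_%:E).
    by rewrite /exp_coeff /= exprMn; ring.
  have cv : (\sum_(0 <= i < n) (expR (- r) * exp_coeff (c * r) i)%R%:E) @[n --> \oo]
      --> (expR (- r) * expR (c * r))%:E.
    under eq_fun do rewrite sumEFin -mulr_sumr.
    apply: cvg_EFin; first exact: nearW.
    by apply: cvgMr; exact: is_cvg_series_exp_coeff.
  by rewrite (cvg_lim _ cv)// -expRD -EFinM -EFinN /=; congr (expR _)%:E; ring.
rewrite gt0_muley ?lte_fin ?subr_gt0//= eseries0// => n _ _.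
suff -> : P [set w | N w = n%:R%:E] = 0 by rewrite mule0.
apply/eqP; rewrite eq_le measure_ge0 andbT.
rewrite [X in _ <= X](_ : _ = P (~` [set w | N w = +oo])).
  by apply: le_measure; rewrite ?inE//; [exact: measurableC|move=> w /= ->].
by rewrite probability_setC// PN subee.
Qed.

End poisson_pgf.

(** * Laplace functional of a Poisson process *)

Section laplace.
Context {d} {T : measurableType d} {R : realType} (P : probability T R).

Lemma cvg_integral_unit (f : nat -> T -> R) (g : T -> R) :
  (forall n, measurable_fun setT (f n)) -> measurable_fun setT g ->
  (forall n w, 0 <= f n w <= 1)%R -> (forall w, f n w @[n --> \oo] --> g w) ->
  \int[P]_w (f n w)%:E @[n --> \oo] --> \int[P]_w (g w)%:E.
Proof.
move=> mf mg f01 fg.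
have [] // := @dominated_convergence _ T R P setT measurableT
  (fun n => EFin \o f n) (EFin \o g) (cst 1).
- by move=> n; apply/measurable_EFinP.
- by apply/measurable_EFinP.
- by apply: aeW => w _; apply: cvg_EFin; [exact: nearW|exact: fg].
- exact: finite_measure_integrable_cst.
- apply: aeW => w n _ /=; rewrite lee_fin ger0_norm; by case/andP: (f01 n w).
Qed.

Lemma prod_itv01 (I : Type) (s : seq I) (F : I -> R) :
  (forall i, 0 <= F i <= 1)%R -> (0 <= \prod_(i <- s) F i <= 1)%R.
Proof.
move=> F01; elim: s => [|i s /andP[IH0 IH1]]; first by rewrite big_nil ler01 lexx.
by case/andP: (F01 i) => F0 F1; rewrite big_cons mulr_ge0//= mulr_ile1.
Qed.

Lemma cvg_prodr (I : eqType) (s : seq I) (F : nat -> I -> R) (l : I -> R) :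
  (forall i, i \in s -> F n i @[n --> \oo] --> l i) ->
  (\prod_(i <- s) F n i)%R @[n --> \oo] --> (\prod_(i <- s) l i)%R.
Proof.
elim: s => [_|i s IH Fl].
  by rewrite big_nil; under eq_fun do rewrite big_nil; exact: cvg_cst.
rewrite big_cons; under eq_fun do rewrite big_cons.
apply: cvgM; first by apply: Fl; rewrite mem_head.
by apply: IH => j js; apply: Fl; rewrite inE js orbT.
Qed.

Lemma expeR_prod (I : Type) (s : seq I) (F : I -> \bar R) :
  (forall i, 0 <= F i) ->
  \prod_(i <- s) expeR (- F i) = expeR (- \sum_(i <- s) F i).
Proof.
move=> F0; elim: s => [|i s IH]; first by rewrite !big_nil oppe0 expeR0.
rewrite !big_cons IH -expeRD oppeD//.
by apply: ge0_adde_def; rewrite inE// sume_ge0.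
Qed.

Lemma measurable_poisson_functional (X : nat -> T -> \bar R) (h : \bar R -> R) J :
  (forall j, measurable_fun setT (X j)) -> measurable_fun setT h ->
  measurable_fun setT (fun w => \prod_(j < J) h (X j w))%R.
Proof.
by move=> mX mh; apply: measurable_prod => j _; apply: measurableT_comp.
Qed.

(** Every further factor is at most 1. Monotonicity provides a limit in [J] before its value is
    known. *)
Lemma nonincreasing_poisson_functional (X : nat -> T -> \bar R) (h : \bar R -> R) :
  (forall j, measurable_fun setT (X j)) -> measurable_fun setT h ->
  (forall x, 0 <= h x <= 1)%R ->
  nonincreasing_seq (fun J => \int[P]_w (\prod_(j < J) h (X j w))%R%:E).
Proof.
move=> mX mh h01; apply/nonincreasing_seqP => J.
have p01 J' w : (0 <= \prod_(j < J') h (X j w) <= 1)%R by apply: (@prod_itv01 _ _ (fun j :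
  'I_J' => h (X j w))) => j; exact: h01.
apply: ge0_le_integral => //.
- by move=> w _; rewrite lee_fin; case/andP: (p01 J.+1 w).
- by apply/measurable_EFinP; exact: (@measurable_poisson_functional X h).
- by apply/measurable_EFinP; exact: (@measurable_poisson_functional X h).
move=> w _; rewrite lee_fin big_ord_recr/= ler_piMr//.
  by case/andP: (p01 J w).
by case/andP: (h01 (X J w)).
Qed.

Variables (lambda : R -> R) (X : nat -> T -> \bar R).
Hypothesis mlambda : measurable_fun (`[0%R, +oo[ : set R) lambda.
Hypothesis lambda0 : forall r, (0 <= r)%R -> (0 <= lambda r)%R.
Hypothesis ppp : poisson_point_process P lambda X.

Local Notation mu := (@lebesgue_measure R).

(** Grouping the indices by the value of [s] leaves, in the limit, one factor [(1 - v) ^ N(A_v)] for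
    each nonzero value [v]. These counts are independent and Poisson, and the exponents, [v] times
    the mass of [A_v], add up to the integral of [s * lambda]. By [s +oo = 0], indices without a
    point contribute the factor 1. *)
Lemma poisson_functional_sfun (s : {nnsfun \bar R >-> R}) :
  (forall x, s x <= 1)%R -> s +oo = 0%R ->
  \int[P]_w (\prod_(j < J) (1 - s (X j w)))%R%:E @[J --> \oo] -->
    expeR (- \int[mu]_(r in `[0%R, +oo[) (s r%:E * lambda r)%:E).
Proof.
move=> s1 sy.
pose vs := [seq v <- fset_set (range s) | v != 0%R].
have uvs : uniq vs by rewrite filter_uniq ?fset_uniq.
pose v i := nth 0%R vs i.
(* Beyond [size vs] the value [v i] defaults to 0, and the last condition makes [A i] empty: [A] is
   then an infinite disjoint family, as [ppp_independent] expects. *)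
pose A i := [set r : R | [/\ (0 <= r)%R, s r%:E = v i & v i != 0%R]].
have v01 i : (0 <= v i <= 1)%R.
  have [ik|ik] := ltnP i (size vs); last by rewrite /v nth_default// lexx ler01.
  have : v i \in vs by exact: mem_nth.
  rewrite mem_filter => /andP[_]; rewrite in_fset_set// inE => -[x _ <-].
  by rewrite s1 andbT.
have vk i : (i < size vs)%N -> v i != 0%R.
  by move=> ik; have := mem_nth 0%R ik; rewrite mem_filter => /andP[].
have mA i : measurable (A i).
  have [vi0|vi0] := eqVneq (v i) 0%R.
    rewrite (_ : A i = set0)//; apply/seteqP; split=> // r [_ _].
    by rewrite vi0 eqxx.
  rewrite (_ : A i = `[0%R, +oo[ `&` EFin @^-1` (s @^-1` [set v i])); last first.
    apply/seteqP; split=> r /=; rewrite in_itv/= andbT; first by case.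
    by case.
  apply: measurableI => //.
  have := @EFin_measurable R setT measurableT (s @^-1` [set v i]).
  by rewrite setTI; apply; exact: measurable_funPTI.
have A0 i : A i `<=` `[0%R, +oo[.
  by move=> r [r0 _ _]; rewrite /= in_itv/= r0.
have tA : trivIset setT A.
  move=> i j _ _ [r [[_ ri vi0] [_ rj vj0]]].
  have vlt l : v l != 0%R -> (l < size vs)%N.
    by apply: contraNT; rewrite -leqNgt => /(nth_default 0%R) /eqP.
  by apply/eqP; rewrite -(nth_uniq 0%R _ _ uvs) ?vlt// -/(v i) -/(v j) -ri -rj.
have XA i w j : (X j w \in EFin @` A i) = (v i != 0%R) && (s (X j w) == v i).
  apply/idP/idP; first by rewrite inE => -[r [r0 sr vi0] <-]; rewrite sr vi0 eqxx.
  move=> /andP[vi0 /eqP sv]; rewrite inE.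
  have := ppp_ge0 ppp j w; case: (X j w) sv => [r sr r0| |//].
  - by exists r.
  - by rewrite sy => v0; rewrite -v0 eqxx in vi0.
pose N i w := point_count (X ^~ w) (EFin @` A i).
have mN i : measurable_fun setT (N i).
  apply: measurable_point_count; first exact: ppp_measurable ppp.
  by apply: measurable_image_EFin; exact: mA.
(* Exactly one [A i] contains the point if [s] does not vanish there, and none otherwise. *)
have prodE J w : (\prod_(j < J) (1 - s (X j w)) =
   \prod_(i <- iota 0 (size vs)) \prod_(j < J) if X j w \in EFin @` A i then 1 - v i else 1)%R.
  rewrite exchange_big /=; apply: eq_bigr => j _.
  have [s0|s0] := eqVneq (s (X j w)) 0%R.
    rewrite s0 subr0 big1_seq// => i /andP[_]; rewrite mem_iota add0n => ik.
    by rewrite XA s0 [_ == v i]eq_sym (negbTE (vk _ ik)) andbF.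
  have svs : s (X j w) \in vs.
    by rewrite mem_filter s0/= in_fset_set// inE; exists (X j w).
  have ik : (index (s (X j w)) vs < size vs)%N by rewrite index_mem.
  rewrite (bigD1_seq (index (s (X j w)) vs)) ?mem_iota ?iota_uniq//=.
  rewrite XA vk// /v nth_index// eqxx/= big1_seq ?mulr1// => i /andP[ine].
  rewrite mem_iota add0n => ik'; rewrite XA vk//=; case: eqP => // sv.
  by rewrite sv /v index_uniq// eqxx in ine.
have m0 i : 0 <= \int[mu]_(r in A i) (lambda r)%:E.
  by apply: integral_ge0 => r [r0 _ _]; rewrite lee_fin lambda0.
have step : \int[P]_w (\prod_(j < J) (1 - s (X j w)))%R%:E @[J --> \oo] -->
    \int[P]_w (\prod_(i <- iota 0 (size vs)) epow (1 - v i) (N i w))%R%:E.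
  apply: cvg_integral_unit.
  - move=> J; apply: (@measurable_poisson_functional X (fun x => 1 - s x)%R).
      exact: ppp_measurable ppp.
    by apply: measurable_funB.
  - by apply: measurable_prod => i _; apply: (measurableT_comp (measurable_epow _)).
  - by move=> J w; apply: prod_itv01 => j; rewrite subr_ge0 s1 gerBl/=.
  - move=> w; under eq_fun do rewrite prodE.
    apply: cvg_prodr => i; rewrite mem_iota add0n => /vk vi0.
    apply: cvg_prod_epow; case/andP: (v01 i) => v0 v1.
    by rewrite subr_ge0 v1 gtrBl lt_neqAle eq_sym vi0.
move: step; rewrite (@integral_prod_mutually_independent _ _ _ P _ _ _ N (fun i => epow (1 - v
  i)))//; last 4 first.
- by move=> i; exact: measurable_epow.
- by move=> i y; apply: epow_itv; case/andP: (v01 i) => ? ?; rewrite subr_ge0 gerBl; apply/andP.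
- exact: ppp_independent ppp _ mA A0 tA.
- exact: iota_uniq.
rewrite (_ : \prod_(i <- _) _ = expeR (- \int[mu]_(r in `[0%R, +oo[) (s r%:E * lambda r)%:E))//.
rewrite big_seq; under eq_bigr => i.
  rewrite mem_iota add0n => /= ik;
    rewrite (@poisson_pgf _ _ _ P (\int[mu]_(r in A i) (lambda r)%:E))//; last 3 first.
  - by move=> w; exact: point_count_nat.
  - case/andP: (v01 i) => v0 v1; rewrite subr_ge0 v1 gtrBl lt_neqAle v0 eq_sym vk//.
  - exact: ppp_poisson ppp _ (mA i) (A0 i).
  rewrite opprB addrC subrK; over.
rewrite -big_seq expeR_prod; last first.
  by move=> i; rewrite mule_ge0// lee_fin; case/andP: (v01 i).
congr (expeR (- _)).
(* The integrals over the [A i] are brought to a common domain so that their sum becomes one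
   integral. *)
pose g i r := (v i)%:E * ((EFin \o lambda) \_ (A i)) r.
have mlA i : measurable_fun (`[0%R, +oo[ : set R) ((EFin \o lambda) \_ (A i)).
  apply/measurable_restrict => //.
  by apply: measurable_funS (@subIsetl _ _ _) _ => //; apply/measurable_EFinP.
have mg i : measurable_fun (`[0%R, +oo[ : set R) (g i).
  by apply: measurable_funeM; exact: mlA.
have lA0 i r : 0 <= ((EFin \o lambda) \_ (A i)) r.
  by rewrite patchE; case: ifPn => // /[!inE] -[r0 _ _]; rewrite lee_fin lambda0.
transitivity (\sum_(i <- iota 0 (size vs)) \int[mu]_(r in `[0%R, +oo[) g i r).
  apply: eq_bigr => i _; rewrite -{1}(setIidr (A0 i)) integral_mkcondr.
  rewrite ge0_integralZl//; last by rewrite lee_fin; case/andP: (v01 i).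
  exact: mlA.
rewrite -ge0_integral_sum//; last first.
  by move=> i r _; rewrite mule_ge0// lee_fin; case/andP: (v01 i).
apply: eq_integral => r; rewrite inE/= in_itv/= andbT => r0; rewrite /g.
have [s0|s0] := eqVneq (s r%:E) 0%R.
  rewrite s0 mul0r big1_seq// => i /andP[_]; rewrite mem_iota add0n => ik.
  rewrite patchE memNset ?mule0// => -[_ sv _].
  by have := vk _ ik; rewrite -sv s0 eqxx.
have svs : s r%:E \in vs.
  by rewrite mem_filter s0/= in_fset_set// inE; exists r%:E.
have ik : (index (s r%:E) vs < size vs)%N by rewrite index_mem.
rewrite (bigD1_seq (index (s r%:E) vs)) ?mem_iota ?iota_uniq//=.
rewrite big1_seq ?adde0; last first.
  move=> i /andP[ine]; rewrite mem_iota add0n => ik'.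
  rewrite patchE memNset ?mule0// => -[_ sv _].
  by rewrite sv /v index_uniq// eqxx in ine.
rewrite patchE mem_set; last by split; rewrite // /v nth_index.
by rewrite /v nth_index.
Qed.

(* The functionals of the simple approximations [1 - s n] bound the one of [h]
   from above, and are themselves bounded below by their limits in [J], so that
   the limits in [n] and in [J] need not be exchanged. *)
Lemma poisson_functional (h : \bar R -> R) :
  measurable_fun setT h -> (forall x, 0 <= h x <= 1)%R -> h +oo = 1%R ->
  \int[P]_w (\prod_(j < J) h (X j w))%R%:E @[J --> \oo] -->
    expeR (- \int[mu]_(r in `[0%R, +oo[) ((1 - h r%:E) * lambda r)%:E).
Proof.
move=> mh h01 hy.
have mX := ppp_measurable ppp.
have mh1 : measurable_fun setT (fun x => (1 - h x)%:E).
  by apply/measurable_EFinP; apply: measurable_funB.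
pose s := nnsfun_approx (@measurableT _ (\bar R)) mh1.
have scvg x : (s n x)%:E @[n --> \oo] --> (1 - h x)%:E.
  by apply: cvg_nnsfun_approx => // y _; rewrite lee_fin subr_ge0; case/andP: (h01 y).
have snd x m n : (m <= n)%N -> (s m x <= s n x)%R.
  by move=> mn; exact/lefP/nd_nnsfun_approx.
have sle n x : (s n x <= 1 - h x)%R.
  rewrite -lee_fin; apply: (@cvge_ge _ _ _ _ _ _ _ _ (scvg x)).
  by exists n => // m /= nm; rewrite lee_fin snd.
have s1 n x : (s n x <= 1)%R.
  by apply: (le_trans (sle n x)); rewrite gerBl; case/andP: (h01 x).
have sy n : s n +oo = 0%R.
  by apply/eqP; rewrite eq_le; have := sle n +oo; rewrite hy subrr => -> /=.
pose a J := \int[P]_w (\prod_(j < J) h (X j w))%R%:E.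
pose l n := \int[mu]_(r in `[0%R, +oo[) (s n r%:E * lambda r)%:E.
pose L := \int[mu]_(r in `[0%R, +oo[) ((1 - h r%:E) * lambda r)%:E.
have lL : l n @[n --> \oo] --> L.
  rewrite /L (_ : \int[mu]_(r in _) _ = \int[mu]_(r in `[0%R, +oo[) limn (fun n => (s n r%:E *
    lambda r)%:E)).
    apply: cvg_monotone_convergence => //.
    - move=> n; apply/measurable_EFinP/measurable_funM => //.
      by apply: measurable_funTS; apply: measurableT_comp.
    - move=> n r; rewrite /= in_itv/= andbT => r0.
      by rewrite lee_fin mulr_ge0 ?lambda0.
    - move=> r; rewrite /= in_itv/= andbT => r0 m n mn.
      by rewrite lee_fin ler_wpM2r ?lambda0// snd.
  apply: eq_integral => r _; apply/esym/cvg_lim => //.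
  by rewrite EFinM; apply: (cvgeZr _ (scvg _)).
have sn01 n x : (0 <= 1 - s n x <= 1)%R by rewrite subr_ge0 s1 gerBl/=.
have msn n : measurable_fun setT (fun x => 1 - s n x)%R by apply: measurable_funB.
have ani : nonincreasing_seq a by exact: (nonincreasing_poisson_functional mX mh h01).
have ale n : limn a <= expeR (- l n).
  rewrite -(cvg_lim _ (poisson_functional_sfun (s1 n) (sy n)))//.
  apply: lee_lim; first exact: ereal_nonincreasing_is_cvgn.
    by apply: cvgP (poisson_functional_sfun (s1 n) (sy n)).
  apply: nearW => J; apply: ge0_le_integral => //.
  - by move=> w _; rewrite lee_fin;
    case/andP: (@prod_itv01 _ (index_enum 'I_J) (fun j : 'I_J => h (X j w)) (fun=> h01 _)).
  - by apply/measurable_EFinP; exact: (@measurable_poisson_functional X h).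
  - apply/measurable_EFinP; exact: (@measurable_poisson_functional X (fun x => 1 - s n x)%R).
  - move=> w _; rewrite lee_fin; apply: ler_prod => j _.
    by case/andP: (h01 (X j w)) => -> _ /=; have := sle n (X j w); lra.
have age J : expeR (- L) <= a J.
  have cvgn : \int[P]_w (\prod_(j < J) (1 - s n (X j w)))%R%:E @[n --> \oo] --> a J.
    apply: cvg_integral_unit.
    - move=> n; exact: (@measurable_poisson_functional X (fun x => 1 - s n x)%R).
    - exact: (@measurable_poisson_functional X h).
    - by move=> n w; apply: (@prod_itv01 _ _ (fun j : 'I_J => 1 - s n (X j w))%R).
    - move=> w; apply: cvg_prodr => j _.
      rewrite -[h _](subKr 1%R); apply: cvgB; first exact: cvg_cst.
      by have /fine_cvgP[] := scvg (X j w).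
  apply: (@cvge_ge _ _ _ _ _ _ _ _ cvgn); apply: nearW => n.
  apply: (@le_trans _ _ (expeR (- l n))).
    rewrite lee_expeR leeN2; apply: ge0_le_integral => //.
    - by move=> r; rewrite /= in_itv/= andbT => r0; rewrite lee_fin mulr_ge0 ?lambda0.
    - apply/measurable_EFinP/measurable_funM => //.
      by apply: measurable_funTS; apply: measurableT_comp.
    - apply/measurable_EFinP/measurable_funM => //.
      by apply: measurable_funTS; apply/measurable_EFinP; apply: (measurableT_comp mh1).
    - move=> r; rewrite /= in_itv/= andbT => r0.
      by rewrite lee_fin ler_wpM2r ?lambda0.
  apply: (@cvge_le _ _ _ _ _ _ _ _ (poisson_functional_sfun (s1 n) (sy n))).
  exists J => // J' /= JJ'.
  exact: (nonincreasing_poisson_functional mX (msn n) (sn01 n) JJ').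
have cvga := ereal_nonincreasing_is_cvgn ani.
rewrite (_ : expeR _ = limn a)//; apply/eqP; rewrite eq_le; apply/andP; split.
  by apply: lime_ge => //; apply: nearW => J; exact: age.
(* Taking the logarithm [y] of the limit avoids the continuity of [expeR]. *)
have a0 : 0 <= limn a by apply: le_trans (expeR_ge0 (- L)) _; apply: lime_ge => //;
  apply: nearW => J; exact: age.
have [y ya] := expeR_total a0.
rewrite -ya lee_expeR leeNr; apply: (@cvge_le _ _ _ _ _ _ _ _ lL).
by apply: nearW => n; rewrite -leeNr -lee_expeR ya ale.
Qed.

End laplace.

(** * Independent marks and the functional of the received powers *)

Section marking.
Context {R : realType}.

(** Writing the inverse as [x] times the square of the inverse of its absolute value reduces the
    claim to a real power; the factor [x] restores the sign. *)
Lemma measurable_invr : measurable_fun [set: R] (@GRing.inv R).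
Proof.
rewrite (_ : @GRing.inv R = fun x => x * (`|x| `^ (-1)) ^+ 2)%R; last first.
  apply/funext => x; have [->|x0] := eqVneq x 0%R; first by rewrite invr0 mul0r.
  by rewrite powR_inv1// exprVn real_normK ?num_real//; field.
apply: measurable_funM => //; apply: measurable_funX.
apply: (@measurableT_comp _ _ _ _ _ _ (@powR R ^~ (-1)%R)); last exact: normr_measurable.
exact: measurable_powR.
Qed.

Lemma measurable_inve : measurable_fun [set: \bar R] (@inve R).
Proof.
(* The last case covers [+oo], since [fine +oo = 0] and [0^-1 = 0] in [R]. *)
rewrite (_ : @inve R = fun x => if x == 0 then +oo else
    if x == -oo then -oo else (fine x)^-1%R%:E); last first.
  by apply/funext => -[r| |] //=; rewrite /inve ?invr0//=; case: ifPn.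
have mX (x : \bar R) : measurable_fun [set: \bar R] (fun y => y == x).
  apply: (measurable_fun_bool true); rewrite setTI (_ : _ @^-1` _ = [set x]).
    exact: emeasurable_set1.
  by apply/seteqP; split => y /= /eqP.
apply: measurable_fun_ifT => //; apply: measurable_fun_ifT => //.
apply/measurable_EFinP; apply: (measurableT_comp measurable_invr).
exact: fine_measurable.
Qed.

Lemma measurable_fun_inve {d} {T : measurableType d} (f : T -> \bar R) :
  measurable_fun setT f -> measurable_fun setT (fun w => (f w)^-1).
Proof. exact: measurableT_comp measurable_inve. Qed.

(** The law of the pair is the product of the two laws, as they agree on rectangles, and Tonelli
    applies. The target types are arbitrary, so that whole sequences of variables can be treated
    through the sigma-algebras that they generate. *)
Lemma integral_independent_pair {d d1 d2} {T : measurableType d}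
    {T1 : measurableType d1} {T2 : measurableType d2} (P : probability T R)
    (X : T -> T1) (Y : T -> T2) (f : T1 * T2 -> \bar R) :
  measurable_fun setT X -> measurable_fun setT Y ->
  measurable_fun setT f -> (forall z, 0 <= f z) ->
  (forall A B, measurable A -> measurable B ->
    P (X @^-1` A `&` Y @^-1` B) = P (X @^-1` A) * P (Y @^-1` B)) ->
  \int[P]_w f (X w, Y w) = \int[P]_w \int[P]_w' f (X w, Y w').
Proof.
move=> mX mY mf f0 indXY.
pose X' : {mfun T >-> T1} := HB.pack X (isMeasurableFun.Build _ _ _ _ X mX).
pose Y' : {mfun T >-> T2} := HB.pack Y (isMeasurableFun.Build _ _ _ _ Y mY).
have mXY : measurable_fun setT (fun w => (X w, Y w)) by exact: measurable_fun_pair.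
pose XY : {mfun T >-> (T1 * T2)%type} :=
  HB.pack (fun w => (X w, Y w)) (isMeasurableFun.Build _ _ _ _ (fun w => (X w, Y w)) mXY).
transitivity (\int[distribution P XY]_z f z).
  by rewrite ge0_integral_pushforward.
transitivity (\int[distribution P X' \x distribution P Y']_z f z).
  apply: eq_measure_integral => /= A mA _; apply/esym.
  apply: (@product_measure_unique _ _ _ _ _ (distribution P X') (distribution P Y')) => //.
rewrite fubini_tonelli1//.
rewrite ge0_integral_pushforward//; last 2 first.
- exact: measurable_fun_fubini_tonelli_F.
- by move=> x _; exact: integral_ge0.
apply: eq_integral => w _; rewrite /= /fubini_F ge0_integral_pushforward//.
by apply: (measurableT_comp mf); exact: pair1_measurable.
Qed.

Context {d} {T : measurableType d} (P : probability T R).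
Context {dS} {S : measurableType dS} (Q : probability S R).
Variables (lambda : R -> R) (K Psi : S -> R).
Variables (D : nat -> T -> \bar R) (Kj Psij : nat -> T -> R).
Hypothesis mK : measurable_fun setT K.
Hypothesis mPsi : measurable_fun setT Psi.
Hypothesis scs : is_scs P Q lambda K Psi D Kj Psij.

Let mD := ppp_measurable (scs_locations scs).

Lemma measurable_received_power j :
  measurable_fun setT (fun w => received_power D Kj Psij w j).
Proof.
apply: emeasurable_funM; last exact: measurable_fun_inve.
apply/measurable_EFinP/measurable_funM.
  exact: scs_power_measurable scs j.
exact: scs_fading_measurable scs j.
Qed.

Lemma received_power_ge0 w j : 0 <= received_power D Kj Psij w j.
Proof.
apply: mule_ge0; first by rewrite lee_fin mulr_ge0 ?(scs_power_ge0 scs) ?(scs_fading_ge0 scs).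
by rewrite inve_ge0 (ppp_ge0 (scs_locations scs)).
Qed.

(** This replaces conditioning on the locations. The integrand is read on the diagonal of [T * T],
    and independence lets its two arguments vary separately; with the locations frozen, the marks
    are independent with a common law. *)
Lemma received_power_marking (phi : \bar R -> R) J :
  measurable_fun setT phi -> (forall x, 0 <= phi x <= 1)%R ->
  \int[P]_w (\prod_(j < J) phi (received_power D Kj Psij w j))%R%:E =
  \int[P]_w (\prod_(j < J) fine (\int[Q]_s (phi ((K s * Psi s)%:E / D j w)%E)%:E))%R%:E.
Proof.
move=> mphi phi01.
pose M j w := (Kj j w, Psij j w).
have mM j : measurable_fun setT (M j).
  by apply: measurable_fun_pair;
    [exact: scs_power_measurable scs j|exact: scs_fading_measurable scs j].
pose GD := \bigcup_j g_sigma_algebra_preimage (D j).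
pose GM := \bigcup_j g_sigma_algebra_preimage (M j).
have sub (G : set (set T)) : G `<=` measurable -> <<s G >> `<=` measurable.
  by move=> GT; apply: smallest_sub => //; exact: sigma_algebra_measurable.
(* [T] seen with the sigma-algebra of the locations only, resp. of the marks only. *)
pose TD := g_sigma_algebraType GD.
pose TM := g_sigma_algebraType GM.
have mTD : measurable_fun [set: T] (id : T -> TD).
  move=> _ A mA; rewrite setTI preimage_id; apply: sub mA => B [j _ [C mC <-]].
  exact: mD.
have mTM : measurable_fun [set: T] (id : T -> TM).
  move=> _ A mA; rewrite setTI preimage_id; apply: sub mA => B [j _ [C mC <-]].
  exact: mM.
have mD' j : measurable_fun [set: TD] (D j : TD -> \bar R).
  by move=> _ A mA; apply: sub_sigma_algebra; exists j => //; exists A.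
have mM' j : measurable_fun [set: TM] (M j : TM -> R * R).
  by move=> _ A mA; apply: sub_sigma_algebra; exists j => //; exists A.
pose F (z : TD * TM) : \bar R :=
  (\prod_(j < J) phi (((M j z.2).1 * (M j z.2).2)%:E / D j z.1)%E)%R%:E.
have mF : measurable_fun setT F.
  apply/measurable_EFinP; apply: measurable_prod => j _.
  apply: (measurableT_comp mphi); apply: emeasurable_funM.
    apply/measurable_EFinP; apply: measurable_funM.
      by apply: (measurableT_comp measurable_fst); apply: (measurableT_comp (mM' j));
        exact: measurable_snd.
    by apply: (measurableT_comp measurable_snd); apply: (measurableT_comp (mM' j));
      exact: measurable_snd.
  by apply: measurable_fun_inve; apply: (measurableT_comp (mD' j)); exact: measurable_fst.
have F0 z : 0 <= F z by rewrite lee_fin prodr_ge0// => j _;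
  case/andP: (phi01 (((M j z.2).1 * (M j z.2).2)%:E / D j z.1)).
transitivity (\int[P]_w F (w, w)); first by [].
rewrite (integral_independent_pair mTD mTM)//; last first.
  by move=> A B mA mB; exact: scs_marks_locations_independent scs A B mA mB.
apply: eq_integral => w _ /=.
pose g (x : \bar R) (p : R * R) := phi ((p.1 * p.2)%:E / x).
have mg x : measurable_fun setT (g x).
  apply: (measurableT_comp mphi); apply: emeasurable_funM => //.
  by apply/measurable_EFinP/measurable_funM; [exact: measurable_fst|exact: measurable_snd].
transitivity (\int[P]_w' (\prod_(j <- iota 0 J) g (D j w) (M j w'))%R%:E).
  by apply: eq_integral => w' _; rewrite /F -[X in iota _ X]subn0 big_mkord.
rewrite (@integral_prod_mutually_independent _ _ _ P _ _ _ M (fun j => g (D j w)))//;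
  last 3 first.
- by move=> j p; exact: phi01.
- exact: scs_marks_independent scs.
- exact: iota_uniq.
rewrite -[X in iota _ X]subn0 big_mkord -prodEFin.
apply: eq_bigr => j _; rewrite fineK; last first.
  apply: integral_unit_fin_num => //.
  apply: (measurableT_comp mphi); apply: emeasurable_funM => //.
  by apply/measurable_EFinP; exact: measurable_funM.
have mKP : measurable_fun setT (fun s => (K s, Psi s)) by exact: measurable_fun_pair.
(* Both sides become integrals of the same function against the law of the mark, which
   [(Kj j, Psij j)] and [(K, Psi)] share. *)
rewrite -(@ge0_integral_pushforward _ _ _ _ _ _ (mM j) P setT (EFin \o g (D j w)))//;
  last 2 first.
- by apply/measurable_EFinP.
- by move=> p _; rewrite lee_fin; case/andP: (phi01 ((p.1 * p.2)%:E / D j w)).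
rewrite -[RHS](@ge0_integral_pushforward _ _ _ _ _ _ mKP Q setT (EFin \o g (D j w)))//;
  last 2 first.
- by apply/measurable_EFinP.
- by move=> p _; rewrite lee_fin; case/andP: (phi01 ((p.1 * p.2)%:E / D j w)).
apply: eq_measure_integral => B mB _.
exact: scs_identically_distributed scs j B mB.
Qed.

(** Marking reduces the claim to the functional of the locations at [h], the mean of [phi] over the
    marks. An absent station has power 0, so [phi 0 = 1] gives [h +oo = 1]. *)
Lemma received_power_functional (phi : \bar R -> R) :
  measurable_fun (`[0%R, +oo[ : set R) lambda ->
  (forall r, (0 <= r)%R -> (0 <= lambda r)%R) ->
  measurable_fun setT phi -> (forall x, 0 <= phi x <= 1)%R -> phi 0 = 1%R ->
  \int[P]_w (\prod_(j < J) phi (received_power D Kj Psij w j))%R%:E @[J --> \oo] -->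
    expeR (- \int[lebesgue_measure]_(r in `[0%R, +oo[)
      ((1 - fine (\int[Q]_s (phi ((K s * Psi s)%:E / r%:E)%E)%:E)) * lambda r)%:E).
Proof.
move=> mlambda lambda0 mphi phi01 phi0.
under eq_fun do rewrite received_power_marking//.
pose h x := fine (\int[Q]_s (phi ((K s * Psi s)%:E / x)%E)%:E).
have hfin x : \int[Q]_s (phi ((K s * Psi s)%:E / x)%E)%:E \is a fin_num.
  apply: integral_unit_fin_num => //.
  apply: (measurableT_comp mphi); apply: emeasurable_funM => //.
  by apply/measurable_EFinP; exact: measurable_funM.
apply: (poisson_functional mlambda lambda0 (scs_locations scs) (h := h)).
- apply: (measurableT_comp (@fine_measurable R setT measurableT)).
  apply: (measurable_fun_fubini_tonelli_F (m2 := Q)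
    (fun z : \bar R * S => (phi ((K z.2 * Psi z.2)%:E / z.1)%E)%:E)).
    apply/measurable_EFinP; apply: (measurableT_comp mphi); apply: emeasurable_funM.
      apply/measurable_EFinP; apply: measurable_funM.
        by apply: (measurableT_comp mK); exact: measurable_snd.
      by apply: (measurableT_comp mPsi); exact: measurable_snd.
    by apply: measurable_fun_inve; exact: measurable_fst.
  by move=> z; rewrite lee_fin; case/andP: (phi01 ((K z.2 * Psi z.2)%:E / z.1)).
- move=> x; rewrite -!lee_fin fineK//; apply/andP; split.
    by apply: integral_ge0 => s _; rewrite lee_fin; case/andP: (phi01 ((K s * Psi s)%:E / x)).
  apply: integral_unit_le1 => //.
  apply: (measurableT_comp mphi); apply: emeasurable_funM => //.
  by apply/measurable_EFinP; exact: measurable_funM.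
- rewrite /h; under eq_integral do rewrite invey mule0 phi0.
  by rewrite integral_cst//= mul1e probability_setT.
Qed.

End marking.

(** * Change of variables in the exponent *)

Section change_of_variables.
Context {R : realType}.
Local Notation mu := (@lebesgue_measure R).

(** The image of Lebesgue measure under multiplication by [m], rescaled by [m], gives half-open
    intervals their length, hence is Lebesgue measure. *)
Lemma ge0_integral_scale (m : R) (F : R -> \bar R) : (0 < m)%R ->
  measurable_fun setT F -> (forall r, 0 <= F r) ->
  \int[mu]_r F r = \int[mu]_r (m%:E * F (m * r)%R).
Proof.
move=> m0 mF F0.
have mm : measurable_fun [set: measurableTypeR R] ( *%R m : measurableTypeR R ->
  measurableTypeR R).
  exact: mulrl_measurable.
pose phi : {mfun measurableTypeR R >-> measurableTypeR R} :=
  HB.pack ( *%R m : measurableTypeR R -> measurableTypeR R) (isMeasurableFun.Build _ _ _ _ _ mm).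
rewrite ge0_integralZl//; last 2 first.
- exact: (measurableT_comp mF mm).
- by rewrite lee_fin ltW.
rewrite -(@ge0_integral_pushforward _ _ _ _ _ _ mm mu setT F)//.
have m0' : (0 <= m)%R by exact: ltW.
rewrite -(@ge0_integral_mscale _ _ _ (pushforward mu phi) setT measurableT (NngNum m0'))//.
apply: eq_measure_integral => A mA _.
apply: (@lebesgue_measure_unique _ (mscale (NngNum m0') (pushforward mu phi))) => // _ [[a b]]
  _ <- /=.
rewrite /mscale/= /pushforward/=.
rewrite (_ : _ @^-1` _ = `](a / m)%R, (b / m)%R]%classic); last first.
  by apply/seteqP; split => r /=; rewrite !in_itv/= ltr_pdivrMr// ler_pdivlMr// [(r * m)%R]mulrC.
rewrite !lebesgue_measure_itv/= !lte_fin ltr_pM2r ?invr_gt0//.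
case: ifPn => ab; last by rewrite mule0.
by rewrite -!EFinB -EFinM; congr (_%:E); field; rewrite gt_eqF.
Qed.

Context {dS} {S : measurableType dS} (Q : probability S R).
Variables (K Psi : S -> R) (lambda : R -> R).
Hypothesis mK : measurable_fun setT K.
Hypothesis mPsi : measurable_fun setT Psi.
Hypothesis K_ge0 : forall s, (0 <= K s)%R.
Hypothesis Psi_ge0 : forall s, (0 <= Psi s)%R.
Hypothesis mlambda : measurable_fun (`[0%R, +oo[ : set R) lambda.
Hypothesis lambda_ge0 : forall r, (0 <= r)%R -> (0 <= lambda r)%R.

(** [lambda] is controlled only on the half-line; extended by 0 it is measurable and nonnegative on
    all of [R], where Tonelli and the substitution take place. *)
Let l := lambda \_ `[0%R, +oo[.

Let ml : measurable_fun setT l.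
Proof. by apply/(measurable_restrictT lambda (measurable_itv _)). Qed.

Let l_ge0 r : (0 <= l r)%R.
Proof.
rewrite /l patchE; case: ifPn => //.
by rewrite inE /= in_itv/= andbT => /lambda_ge0.
Qed.

Let lE r : (0 <= r)%R -> l r = lambda r.
Proof. by move=> r0; rewrite /l patchE mem_set//= in_itv/= r0. Qed.

Let ln r : ~ (0 <= r)%R -> l r = 0%R.
Proof. by move=> r0; rewrite /l patchE memNset//= in_itv/= andbT. Qed.

Lemma lambda_barE r : lambda_bar Q K Psi lambda r =
  \int[Q]_s (K s * Psi s * lambda (K s * Psi s * r))%:E.
Proof. by rewrite /lambda_bar unlock. Qed.

Lemma lambda_bar_ge0 r : (0 <= r)%R -> 0 <= lambda_bar Q K Psi lambda r.
Proof.
move=> r0; rewrite lambda_barE; apply: integral_ge0 => s _.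
by rewrite lee_fin mulr_ge0// ?lambda_ge0// !mulr_ge0.
Qed.

Let G (z : R * S) := ((K z.2 * Psi z.2) * l (K z.2 * Psi z.2 * z.1))%R.

Let mKP d (T : measurableType d) (f : T -> S) : measurable_fun setT f ->
  measurable_fun setT (fun z => K (f z) * Psi (f z))%R.
Proof. by move=> mf; apply: measurable_funM; apply: measurableT_comp. Qed.

Let mG : measurable_fun setT G.
Proof.
have m2 := @measurable_snd _ _ R S.
apply: measurable_funM; first exact: mKP.
apply: (measurableT_comp ml); apply: measurable_funM; first exact: mKP.
exact: measurable_fst.
Qed.

Lemma measurable_lambda_bar :
  measurable_fun (`[0%R, +oo[ : set R) (fun r => fine (lambda_bar Q K Psi lambda r)).
Proof.
apply: (@eq_measurable_fun _ _ _ _ _ (fun r => fine (\int[Q]_s (G (r, s))%:E))).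
  move=> r; rewrite inE /= in_itv/= andbT => r0; rewrite lambda_barE; congr fine.
  by apply: eq_integral => s _; rewrite /G/= lE// !mulr_ge0.
apply: measurable_funTS; apply: (measurableT_comp (@fine_measurable R setT measurableT)).
apply: (measurable_fun_fubini_tonelli_F (m2 := Q) (EFin \o G)).
  exact/measurable_EFinP.
by move=> z; rewrite lee_fin mulr_ge0// mulr_ge0.
Qed.

(** Both sides are double integrals of nonnegative functions on [R * S] that match for each fixed
    [s]. Finiteness of [lambda_bar] makes [fine] faithful on the right. *)
Lemma integral_lambda_bar (phi : \bar R -> R) :
  measurable_fun setT phi -> (forall x, 0 <= phi x <= 1)%R -> phi 0 = 1%R ->
  (forall r, (0 <= r)%R -> lambda_bar Q K Psi lambda r < +oo) ->
  \int[mu]_(r in `[0%R, +oo[)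
      ((1 - fine (\int[Q]_s (phi ((K s * Psi s)%:E / r%:E)%E)%:E)) * lambda r)%:E =
  \int[mu]_(r in `[0%R, +oo[)
      ((1 - phi (1 / r%:E)%E) * fine (lambda_bar Q K Psi lambda r))%:E.
Proof.
move=> mphi phi01 phi0 lbfin.
pose F (z : R * S) := ((1 - phi ((K z.2 * Psi z.2)%:E / z.1%:E)%E) * l z.1)%R.
have mphiKP d (T : measurableType d) (f : T -> S) (g : T -> R) :
    measurable_fun setT f -> measurable_fun setT g ->
    measurable_fun setT (fun z => phi ((K (f z) * Psi (f z))%:E / (g z)%:E)%E).
  move=> mf mg; apply: (measurableT_comp mphi); apply: emeasurable_funM.
    by apply/measurable_EFinP; exact: mKP.
  by apply: measurable_fun_inve; apply/measurable_EFinP.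
have mF : measurable_fun setT F.
  apply: measurable_funM; last by apply: (measurableT_comp ml); exact: measurable_fst.
  by apply: measurable_funB => //; apply: mphiKP; [exact: measurable_snd|exact: measurable_fst].
have phi1 x : (0 <= 1 - phi x)%R by rewrite subr_ge0; case/andP: (phi01 x).
have F0 z : 0 <= (F z)%:E by rewrite lee_fin mulr_ge0.
have G0 z : (0 <= G z)%R by rewrite mulr_ge0// mulr_ge0.
pose H (z : R * S) := ((1 - phi (1 / z.1%:E)%E) * (\1_`[0%R, +oo[ z.1 * G z))%R.
have mphi1 : measurable_fun setT (fun r : R => phi (1 / r%:E)%E).
  by apply: (measurableT_comp mphi); apply: emeasurable_funM => //; exact: measurable_fun_inve.
have mH : measurable_fun setT H.
  apply: measurable_funM.
    apply: measurable_funB => //.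
    by apply: (measurableT_comp mphi1); exact: measurable_fst.
  apply: measurable_funM => //.
  apply: (@measurableT_comp _ _ _ _ _ _ (\1_(`[0%R, +oo[%classic : set R) : R -> R)).
    exact: measurable_indic.
  exact: measurable_fst.
have H0 z : 0 <= (H z)%:E by rewrite lee_fin !mulr_ge0.
transitivity (\int[mu]_r \int[Q]_s (F (r, s))%:E).
  rewrite integral_mkcond; apply: eq_integral => r _; rewrite patchE.
  case: ifPn => [|/negP]; rewrite inE /= in_itv/= andbT => r0; last first.
    by rewrite integral0_eq// => s _; rewrite /F/= ln// mulr0.
  have mp : measurable_fun setT (fun s => phi ((K s * Psi s)%:E / r%:E)%E) by exact: mphiKP.
  have pfin := integral_unit_fin_num Q mp (fun s => phi01 _).
  rewrite /F/= lE//.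
  under [RHS]eq_integral do rewrite mulrC EFinM.
  rewrite ge0_integralZl_EFin ?lambda_ge0//; last 2 first.
  - by move=> s _; rewrite lee_fin.
  - by apply/measurable_EFinP; apply: measurable_funB.
  under [in RHS]eq_integral do rewrite EFinB.
  rewrite integralB//; last 2 first.
  - exact: finite_measure_integrable_cst.
  - exact: integrable_unit.
  rewrite integral_cst//= mul1e probability_setT -[in RHS](fineK pfin).
  by rewrite -EFinB -EFinM mulrC.
transitivity (\int[mu]_r \int[Q]_s (H (r, s))%:E); last first.
  rewrite [RHS]integral_mkcond; apply: eq_integral => r _; rewrite patchE.
  case: ifPn => [|/negP]; rewrite inE /= in_itv/= andbT => r0; last first.
    by rewrite integral0_eq// => s _; rewrite /H/= indicE memNset ?mul0r ?mulr0//= in_itv/= andbT.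
  rewrite EFinM fineK; last by rewrite ge0_fin_numE ?lambda_bar_ge0// lbfin.
  rewrite lambda_barE -ge0_integralZl_EFin//; last 2 first.
  - by move=> s _; rewrite lee_fin mulr_ge0// ?lambda_ge0// !mulr_ge0.
  - apply/measurable_EFinP; apply: (@eq_measurable_fun _ _ _ _ _ (fun s => G (r, s))).
      by move=> s _; rewrite /G/= lE// !mulr_ge0.
    by apply: (measurableT_comp mG); exact: pair1_measurable.
  apply: eq_integral => s _; rewrite -EFinM /H/= indicE mem_set/= ?mul1r.
    by rewrite /G/= lE// !mulr_ge0.
  by rewrite in_itv/= r0.
have mF' : measurable_fun setT (EFin \o F) by exact/measurable_EFinP.
have mH' : measurable_fun setT (EFin \o H) by exact/measurable_EFinP.
transitivity (\int[Q]_s \int[mu]_r (F (r, s))%:E).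
  exact: (fubini_tonelli (m1 := mu) (m2 := Q) (EFin \o F) mF' F0).
transitivity (\int[Q]_s \int[mu]_r (H (r, s))%:E); last first.
  by apply/esym; exact: (fubini_tonelli (m1 := mu) (m2 := Q) (EFin \o H) mH' H0).
apply: eq_integral => s _; rewrite /F/H/=.
have : (0 <= K s * Psi s)%R by rewrite mulr_ge0.
set m := (K s * Psi s)%R; rewrite le_eqVlt => /predU1P[m0|m0].
  (* If [K Psi = 0] both inner integrals vanish: the left one by [phi 0 = 1], the right one by the
     factor [K Psi]. *)
  rewrite -m0 !integral0_eq// => r _; first by rewrite /G/= -/m -m0 mul0r !mulr0.
  by rewrite mul0e phi0 subrr mul0r.
rewrite [LHS](ge0_integral_scale m0)//; last 2 first.
- exact: (measurableT_comp mF' (pair2_measurable s)).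
- by move=> r; exact: (F0 (r, s)).
apply: eq_integral => r _; rewrite -EFinM; congr (_%:E).
rewrite /G/= -/m mulrCA.
have -> : m%:E / (m * r)%:E = 1 / r%:E.
  (* At [r = 0] both quotients are +oo, since [m > 0]. *)
  have [->|r0] := eqVneq r 0%R.
    by rewrite mulr0 inve0 mul1e gt0_muley ?lte_fin.
  by rewrite !inver mulf_eq0 (gt_eqF m0) (negbTE r0)/= -!EFinM; congr (_%:E); field;
    rewrite r0 gt_eqF.
congr (_ * _)%R.
have [r0|r0] := leP 0%R r.
  by rewrite indicE mem_set ?mul1r//= in_itv/= r0.
rewrite indicE memNset ?mul0r ?ln ?mulr0//; last by rewrite /= in_itv/= andbT; apply/negP;
  rewrite -ltNge.
by apply/negP; rewrite -ltNge pmulr_rlt0.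
Qed.

End change_of_variables.

(** * Weighted means of bounded functions of a count *)

Section bounded_functional.
Context {R : realType} {d} {T : measurableType d} (P : probability T R).
Variables (W : T -> R) (Y : T -> \bar R).
Hypothesis mW : measurable_fun setT W.
Hypothesis W01 : forall w, (0 <= W w <= 1)%R.
Hypothesis mY : measurable_fun setT Y.
Hypothesis natY : forall w, ext_nat (Y w).

(** The bound is asked only at possible values of a count: the approximations of the indicators of
    points used below are not uniformly bounded at other reals. *)
Definition bounded_ext_nat (g : \bar R -> R) (M : R) :=
  measurable_fun setT g /\ forall x, ext_nat x -> (`|g x| <= M)%R.

(** The weight [W] carries the information on the other counts, so that a joint law can be
    determined one count at a time. *)
Definition weighted_mean (g : \bar R -> R) := \int[P]_w (W w * g (Y w))%:E.

Lemma normr_weight g M w : bounded_ext_nat g M -> (`|W w * g (Y w)| <= M)%R.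
Proof.
move=> [_ gM]; case/andP: (W01 w) => W0 W1; rewrite normrM ger0_norm//.
by rewrite -[leRHS]mul1r ler_pM// gM.
Qed.

Lemma measurable_weight g : measurable_fun setT g ->
  measurable_fun setT (fun w => W w * g (Y w))%R.
Proof. by move=> mg; apply: measurable_funM => //; exact: measurableT_comp. Qed.

Lemma integrable_weight g M : bounded_ext_nat g M ->
  P.-integrable setT (fun w => (W w * g (Y w))%:E).
Proof.
move=> gM; apply: (@le_integrable _ _ _ _ _ measurableT _ (cst M%:E)).
- by apply/measurable_EFinP; apply: measurable_weight; case: gM.
- move=> w _; rewrite lee_fin [leRHS]ger0_norm ?normr_weight//.
  by apply: le_trans (normr_weight w gM).
- exact: finite_measure_integrable_cst.
Qed.

Lemma weighted_mean_lin f g a b M N : bounded_ext_nat f M -> bounded_ext_nat g N ->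
  weighted_mean (fun x => a * f x + b * g x)%R =
  a%:E * weighted_mean f + b%:E * weighted_mean g.
Proof.
move=> fM gN; rewrite /weighted_mean -!integralZl//;
  [|exact: integrable_weight gN|exact: integrable_weight fM].
rewrite -integralD//; last 2 first.
- by apply: integrableZl => //; exact: integrable_weight fM.
- by apply: integrableZl => //; exact: integrable_weight gN.
by apply: eq_integral => w _; rewrite -!EFinM -EFinD; congr (_%:E); ring.
Qed.

Lemma weighted_mean_cvg (f : nat -> \bar R -> R) (g : \bar R -> R) (M : R) :
  (forall k, bounded_ext_nat (f k) M) -> measurable_fun setT g ->
  (forall x, ext_nat x -> f k x @[k --> \oo] --> g x) ->
  weighted_mean (f k) @[k --> \oo] --> weighted_mean g.
Proof.
move=> fM mg fg.
have [] // := @dominated_convergence _ T R P setT measurableT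
  (fun k w => (W w * f k (Y w))%:E) (fun w => (W w * g (Y w))%:E) (cst M%:E).
- by move=> k; apply/measurable_EFinP; apply: measurable_weight; case: (fM k).
- by apply/measurable_EFinP; exact: measurable_weight.
- apply: aeW => w _; apply: cvg_EFin; first exact: nearW.
  by apply: cvgM; [exact: cvg_cst|exact: fg].
- exact: finite_measure_integrable_cst.
- by apply: aeW => w k _; rewrite lee_fin (normr_weight w (fM k)).
Qed.

End bounded_functional.

(** * Moment uniqueness for counts that may be infinite *)

Section moment_uniqueness.
Context {R : realType} {d1} {T1 : measurableType d1} (P1 : probability T1 R)
  {d2} {T2 : measurableType d2} (P2 : probability T2 R).
Variables (W1 : T1 -> R) (Y1 : T1 -> \bar R) (W2 : T2 -> R) (Y2 : T2 -> \bar R).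
Hypothesis mW1 : measurable_fun setT W1.
Hypothesis W101 : forall w, (0 <= W1 w <= 1)%R.
Hypothesis mY1 : measurable_fun setT Y1.
Hypothesis natY1 : forall w, ext_nat (Y1 w).
Hypothesis mW2 : measurable_fun setT W2.
Hypothesis W201 : forall w, (0 <= W2 w <= 1)%R.
Hypothesis mY2 : measurable_fun setT Y2.
Hypothesis natY2 : forall w, ext_nat (Y2 w).

(** The test functions on which the two weighted laws agree form a vector space closed under
    uniformly bounded limits. The aim is to reach all indicators from the moments. *)
Let good (g : \bar R -> R) := (exists M, bounded_ext_nat g M) /\
  weighted_mean P1 W1 Y1 g = weighted_mean P2 W2 Y2 g.

Let good_lin f g a b : good f -> good g -> good (fun x => a * f x + b * g x)%R.
Proof.
move=> [[M fM] f12] [[N gN] g12]; split; last first.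
  by rewrite (weighted_mean_lin P1 mW1 W101 mY1 natY1 _ _ fM gN) (weighted_mean_lin P2 mW2 W201
    mY2 natY2 _ _ fM gN) f12 g12.
exists (`|a| * M + `|b| * N)%R; split.
  by apply: measurable_funD; apply: measurable_funM => //; [case: fM|case: gN].
move=> x nx; apply: (le_trans (ler_normD _ _)); rewrite !normrM.
by apply: lerD; apply: ler_wpM2l => //; [case: fM|case: gN] => _; apply.
Qed.

Let good_lim (f : nat -> \bar R -> R) (g : \bar R -> R) (M : R) :
  (forall k, good (f k)) -> measurable_fun setT g ->
  (forall k x, ext_nat x -> `|f k x| <= M)%R ->
  (forall x, ext_nat x -> f k x @[k --> \oo] --> g x) -> good g.
Proof.
move=> gf mg fM fg.
have bf k : bounded_ext_nat (f k) M.
  by split; [case: (gf k) => -[N []]|exact: fM].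
split.
  exists M; split=> // x nx.
  have h : `|f k x|%R @[k --> \oo] --> `|g x|%R by apply: cvg_norm; exact: fg.
  rewrite -(cvg_lim _ h)//; apply: limr_le; first by apply/cvg_ex; exists `|g x|%R.
  by apply: nearW => k; exact: fM.
have c1 := weighted_mean_cvg (P := P1) mW1 W101 mY1 natY1 bf mg fg.
have c2 := weighted_mean_cvg (P := P2) mW2 W201 mY2 natY2 bf mg fg.
rewrite (_ : (fun k => weighted_mean P1 W1 Y1 (f k)) = (fun k => weighted_mean P2 W2 Y2 (f k)))
  in c1.
  exact: (cvg_unique _ c1 c2).
by apply/funext => k; case: (gf k).
Qed.

Hypothesis moments : forall k, weighted_mean P1 W1 Y1 (fun y => epow (1 / 2) y ^+ k)%R =
  weighted_mean P2 W2 Y2 (fun y => epow (1 / 2) y ^+ k)%R.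

Let half01 : (0 <= (1 / 2 : R) <= 1)%R.
Proof. by apply/andP; split; lra. Qed.

Let good_moment k : good (fun y => epow (1 / 2) y ^+ k)%R.
Proof.
split=> //; exists 1%R; split.
  by apply: measurable_funX; exact: measurable_epow.
move=> x _; have /andP[e0 e1] := @epow_itv R _ x half01.
by rewrite ger0_norm ?exprn_ge0// exprn_ile1.
Qed.

Let good0 : good (cst 0%R).
Proof.
rewrite (_ : cst _ = (fun y => 0 * epow (1 / 2) y ^+ 0 + 0 * epow (1 / 2) y ^+ 0)%R).
  exact: good_lin.
by apply/funext => y; rewrite !mul0r addr0.
Qed.

Let good_sum n (f : nat -> \bar R -> R) (c : nat -> R) :
  (forall k, (k < n)%N -> good (f k)) -> good (fun y => \sum_(k < n) c k * f k y)%R.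
Proof.
elim: n => [_|n IH gf].
  by rewrite (_ : (fun _ => _) = cst 0%R)//; apply/funext => y; rewrite big_ord0.
rewrite (_ : (fun _ => _) = (fun y => 1 * (\sum_(k < n) c k * f k y) + c n * f n y)%R).
  by apply: good_lin; [apply: IH => k kn; exact/gf/ltnW|exact: gf].
by apply/funext => y; rewrite big_ord_recr mul1r.
Qed.

Let point n (y : \bar R) : R := \1_[set n%:R%:E] y.

Let pointE n m : point n m%:R%:E = (n == m)%:R%R.
Proof.
rewrite /point indicE; have [->|nm] := eqVneq n m; first by rewrite mem_set.
by rewrite memNset//= => -[/eqP]; rewrite eqr_nat eq_sym (negbTE nm).
Qed.

Let pointy n : point n +oo = 0%R.
Proof. by rewrite /point indicE memNset. Qed.

Let measurable_point n : measurable_fun setT (point n).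
Proof. by apply: measurable_indic; exact: emeasurable_set1. Qed.

(* [1_{N = n}] is the limit of [2 ^ (k n) 2 ^ (- k N) - \sum_(m < n) 2 ^ (k (n - m)) 1_{N =
  m}]. *)
Let good_point n : good (point n).
Proof.
elim/ltn_ind: n => n IH.
(* With exponent [k.+1] rather than [k], the power of [epow (1 / 2) +oo = 0] is 0 for every [k], so
   [f k] vanishes at +oo. *)
pose f k y : R := (2 ^+ (k.+1 * n) * epow (1 / 2) y ^+ k.+1
  + (-1) * \sum_(m < n) 2 ^+ (k.+1 * (n - m)) * point m y)%R.
have fnat k m : f k m%:R%:E = if (m < n)%N then 0%R else ((1 / 2) ^+ (k.+1 * (m - n)))%R.
  have p2 : (2 != 0 :> R)%R by rewrite pnatr_eq0.
  have powE : (((1 / 2) ^+ m) ^+ k.+1 = (2 ^+ (k.+1 * m))^-1 :> R)%R.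
    by rewrite -exprM [(m * _)%N]mulnC expr_div_n expr1n div1r.
  rewrite /f epow_nat; last by case/andP: half01.
  case: ifPn => mn.
    rewrite (bigD1 (Ordinal mn))//= pointE eqxx mulr1 big1 ?addr0; last first.
      move=> i /negP im; rewrite pointE; case: eqP => [e|]; last by rewrite mulr0.
      by exfalso; apply: im; apply/eqP/val_inj.
    rewrite powE mulnBr expfB_cond ?mulN1r ?subrr// (negbTE p2) add0n leq_mul2l.
    by rewrite ltnW.
  rewrite -leqNgt in mn.
  rewrite big1 ?mulr0 ?addr0; last first.
    move=> i _; rewrite pointE; case: eqP => [e|]; last by rewrite mulr0.
    by move: (ltn_ord i); rewrite e ltnNge mn.
  rewrite powE expr_div_n expr1n div1r mulnBr expfB_cond ?invf_div//.
  by rewrite (negbTE p2) add0n leq_mul2l mn.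
have fy k : f k +oo = 0%R.
  by rewrite /f epowy expr0n mulr0 big1 ?mulr0 ?addr0// => i _; rewrite pointy mulr0.
apply: (@good_lim f (point n) 1%R) => //.
- move=> k; rewrite /f; apply: good_lin; first exact: good_moment.
  by apply: (@good_sum n point (fun m => 2 ^+ (k.+1 * (n - m)))%R) => m mn; exact: IH.
- move=> k x [[m ->]|->]; last by rewrite fy normr0 ler01.
  rewrite fnat; case: ifP => _; first by rewrite normr0 ler01.
  by case/andP: half01 => h0 h1; rewrite ger0_norm ?exprn_ge0// exprn_ile1.
- move=> x [[m ->]|->]; last first.
    by rewrite pointy; under eq_fun do rewrite fy; exact: cvg_cst.
  rewrite pointE; under eq_fun do rewrite fnat.
  have [mn|nm|->] := ltngtP m n.
  + exact: cvg_cst.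
  + under eq_fun do rewrite mulnC exprM.
    have c0 : (((1 / 2) ^+ (m - n)) ^+ k)%R @[k --> \oo] --> (0%R : R).
      apply: cvg_expr; case/andP: half01 => h0 h1; rewrite ger0_norm ?exprn_ge0//.
      by rewrite exprn_ilt1// -?lt0n ?subn_gt0//; lra.
    by rewrite -cvg_shiftS in c0.
  + by under eq_fun do rewrite subnn muln0 expr0; exact: cvg_cst.
Qed.

(** On counts, the indicator [b] of [B] is the constant [b +oo] plus the sum over [n] of
    [b n - b +oo] times the indicator of [n]. The constant is a multiple of the moment of order 0,
    so the mass at +oo is obtained by complement. *)
Lemma weighted_mean_unique (B : set (\bar R)) : measurable B ->
  weighted_mean P1 W1 Y1 (\1_B) = weighted_mean P2 W2 Y2 (\1_B).
Proof.
move=> mB; suff [] : good (\1_B) by [].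
pose b (x : \bar R) : R := \1_B x.
pose f K y : R := (1 * (\sum_(n < K) (b n%:R%:E - b +oo%E) * point n y)
  + b +oo%E * epow (1 / 2) y ^+ 0)%R.
have fnat K n : f K n%:R%:E = if (n < K)%N then b n%:R%:E else b +oo%E.
  rewrite /f expr0 mulr1 mul1r; case: ifPn => nK.
    rewrite (bigD1 (Ordinal nK))//= pointE eqxx mulr1 big1 ?addr0 ?subrK// => i /negP im.
    rewrite pointE; case: eqP => [e|]; last by rewrite mulr0.
    by exfalso; apply: im; apply/eqP/val_inj.
  rewrite big1 ?add0r// => i _; rewrite pointE; case: eqP => [e|]; last by rewrite mulr0.
  by move: (ltn_ord i); rewrite e (negbTE nK).
have fy K : f K +oo = b +oo%E.
  by rewrite /f expr0 mulr1 mul1r big1 ?add0r// => i _; rewrite pointy mulr0.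
have b1 x : (`|b x| <= 1)%R by rewrite /b indicE; case: (_ \in _); rewrite ?normr1 ?normr0.
apply: (@good_lim f (\1_B) 1%R) => //.
- by move=> K; apply: good_lin => //;
  apply: (@good_sum K point (fun n => b n%:R%:E - b +oo%E)%R) => n _; exact: good_point.
- by move=> K x [[n ->]|->]; rewrite ?fy// fnat; case: ifP.
- move=> x [[n ->]|->]; last by under eq_fun do rewrite fy; exact: cvg_cst.
  under eq_fun do rewrite fnat; apply: cvg_near_cst.
  by exists n.+1 => // K /= nK; rewrite nK.
Qed.

End moment_uniqueness.

(** * From the functional to the law of the configuration *)

Section cylinders.
Context {R : realType} {d1} {T1 : measurableType d1} (P1 : probability T1 R)
  {d2} {T2 : measurableType d2} (P2 : probability T2 R).
Variables (p1 : T1 -> nat -> \bar R) (p2 : T2 -> nat -> \bar R).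
Hypothesis mp1 : forall j, measurable_fun setT (p1 ^~ j).
Hypothesis mp2 : forall j, measurable_fun setT (p2 ^~ j).
Hypothesis same_functional : forall phi : \bar R -> R,
  measurable_fun setT phi -> (forall x, 0 <= phi x <= 1)%R -> phi 0 = 1%R ->
  exists l : \bar R,
    \int[P1]_w (\prod_(j < J) phi (p1 w j))%R%:E @[J --> \oo] --> l /\
    \int[P2]_w (\prod_(j < J) phi (p2 w j))%R%:E @[J --> \oo] --> l.

Let half01 : (0 <= (1 / 2 : R) <= 1)%R.
Proof. by apply/andP; split; lra. Qed.

(** The exponents of a mixed moment are the multiplicities in [L], so multiplying by a further power
    amounts to prepending copies of an index. *)
Let Z T (p : T -> nat -> \bar R) (A : nat -> set (\bar R)) (L : seq nat) (w : T) : R :=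
  (\prod_(i <- L) epow (1 / 2) (point_count (p w) (A i)))%R.

Let phi (A : nat -> set (\bar R)) (L : seq nat) (x : \bar R) : R :=
  (\prod_(i <- L) if x \in A i then 1 / 2 else 1)%R.

Let phi01 A L x : (0 <= phi A L x <= 1)%R.
Proof. by apply: prod_itv01 => i; case: ifP => // _; rewrite ler01 lexx. Qed.

Let mphi A L : (forall i, measurable (A i)) -> measurable_fun setT (phi A L).
Proof.
move=> mA; apply: measurable_prod => i _; apply: measurable_fun_ifT => //.
apply: (measurable_fun_bool true); rewrite setTI (_ : _ @^-1` _ = A i)//.
by apply/seteqP; split => x; [exact: set_mem|exact: mem_set].
Qed.

Let mcount d (T : measurableType d) (p : T -> nat -> \bar R) (A : set (\bar R)) :
  (forall j, measurable_fun setT (p ^~ j)) -> measurable A ->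
  measurable_fun setT (fun w => point_count (p w) A).
Proof. by move=> mp mA; exact: (@measurable_point_count _ _ _ (fun j w => p w j)). Qed.

Let mZ d (T : measurableType d) (p : T -> nat -> \bar R) A L :
  (forall j, measurable_fun setT (p ^~ j)) -> (forall i, measurable (A i)) ->
  measurable_fun setT (Z p A L).
Proof.
move=> mp mA; apply: measurable_prod => i _.
by apply: (measurableT_comp (measurable_epow _)); exact: mcount.
Qed.

Let Z01 T (p : T -> nat -> \bar R) A L w : (0 <= Z p A L w <= 1)%R.
Proof. by apply: prod_itv01 => i; exact: epow_itv. Qed.

Let cvgZ d (T : measurableType d) (P : probability T R) (p : T -> nat -> \bar R) A L :
  (forall j, measurable_fun setT (p ^~ j)) -> (forall i, measurable (A i)) ->
  \int[P]_w (\prod_(j < J) phi A L (p w j))%R%:E @[J --> \oo] --> \int[P]_w (Z p A L w)%:E.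
Proof.
move=> mp mA; apply: cvg_integral_unit.
- by move=> J; apply: measurable_prod => j _; apply: (measurableT_comp (mphi L mA)).
- exact: mZ.
- by move=> J w; apply: (@prod_itv01 _ _ _ (fun j : 'I_J => phi A L (p w j))).
- move=> w; under eq_fun do rewrite exchange_big /=.
  apply: cvg_prodr => i _; apply: cvg_prod_epow.
  by apply/andP; split; lra.
Qed.

Let eqZ A L : (forall i, measurable (A i)) -> (forall i, ~ A i 0) ->
  \int[P1]_w (Z p1 A L w)%:E = \int[P2]_w (Z p2 A L w)%:E.
Proof.
move=> mA A0; have [|l [l1 l2]] := same_functional (mphi L mA) (phi01 A L).
  by rewrite /phi big1// => i _; rewrite memNset.
transitivity l; first by apply/esym; exact: (cvg_unique _ l1 (cvgZ (P := P1) (L := L) mp1 mA)).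
exact: (cvg_unique _ l2 (cvgZ (P := P2) (L := L) mp2 mA)).
Qed.

Let box T (p : T -> nat -> \bar R) (A B : nat -> set (\bar R)) n (w : T) : R :=
  (\prod_(i < n) \1_(B i) (point_count (p w) (A i)))%R.

Let mbox d (T : measurableType d) (p : T -> nat -> \bar R) A B n :
  (forall j, measurable_fun setT (p ^~ j)) -> (forall i, measurable (A i)) ->
  (forall i, measurable (B i)) -> measurable_fun setT (box p A B n).
Proof.
move=> mp mA mB; apply: measurable_prod => i _.
apply: (measurableT_comp _ (mcount mp (mA i))); exact: measurable_indic.
Qed.

Let box01 T (p : T -> nat -> \bar R) A B n w : (0 <= box p A B n w <= 1)%R.
Proof.
by apply: prod_itv01 => i; rewrite indicE; case: (_ \in _); rewrite ler01 lexx.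
Qed.

(** The indicators enter one count at a time: [box] for the first [n] counts times [Z] is the weight
    for the next one. The list [L] is arbitrary because the moments of that count are absorbed into
    [Z] before the induction hypothesis applies. *)
Let eq_box A B n L : (forall i, measurable (A i)) -> (forall i, ~ A i 0) ->
  (forall i, measurable (B i)) ->
  \int[P1]_w (box p1 A B n w * Z p1 A L w)%:E = \int[P2]_w (box p2 A B n w * Z p2 A L w)%:E.
Proof.
move=> mA A0 mB; elim: n L => [|n IH] L.
  have E T (p : T -> nat -> \bar R) w : (box p A B 0 w * Z p A L w)%R = Z p A L w.
    by rewrite /box big_ord0 mul1r.
  by under eq_integral do rewrite E; under [RHS]eq_integral do rewrite E; exact: eqZ.
pose W T (p : T -> nat -> \bar R) w := (box p A B n w * Z p A L w)%R.
have W01 T (p : T -> nat -> \bar R) w : (0 <= W T p w <= 1)%R.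
  have /andP[b0 b1] := box01 p A B n w; have /andP[z0 z1] := Z01 p A L w.
  by rewrite mulr_ge0//= mulr_ile1.
have mW d (T : measurableType d) (p : T -> nat -> \bar R) :
    (forall j, measurable_fun setT (p ^~ j)) -> measurable_fun setT (W T p).
  by move=> mp; apply: measurable_funM; [exact: mbox|exact: mZ].
have E T (p : T -> nat -> \bar R) w : (box p A B n.+1 w * Z p A L w)%R =
    (W T p w * \1_(B n) (point_count (p w) (A n)))%R.
  by rewrite /box big_ord_recr/= /W mulrAC.
under eq_integral do rewrite E; under [RHS]eq_integral do rewrite E.
apply: (weighted_mean_unique (mW _ _ _ mp1) (W01 _ _) (mcount mp1 (mA n))
  _ (mW _ _ _ mp2) (W01 _ _) (mcount mp2 (mA n)) _ _ (mB n)).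
- by move=> w; exact: point_count_nat.
- by move=> w; exact: point_count_nat.
move=> k; have E' T (p : T -> nat -> \bar R) w :
    (W T p w * epow (1 / 2) (point_count (p w) (A n)) ^+ k)%R =
    (box p A B n w * Z p A (nseq k n ++ L) w)%R.
  rewrite /W -mulrA; congr (_ * _)%R; rewrite /Z big_cat mulrC; congr (_ * _)%R.
  by rewrite big_nseq iter_mulr_1.
by rewrite /weighted_mean; under eq_integral do rewrite E';
  under [RHS]eq_integral do rewrite E'; exact: IH.
Qed.

(** Cylinders on a single set need not be stable under intersection; these finite intersections form
    a pi-system whose sigma-algebra contains them. *)
Let finite_cylinders : set_system (set (\bar R) -> \bar R) :=
  [set E | exists n A B, [/\ forall i : nat, measurable (A i), forall i, ~ A i 0,
     forall i : nat, measurable (B i) & E = [set m | forall i, (i < n)%N -> B i (m (A i))]]].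

Let finite_cylindersI : setI_closed finite_cylinders.
Proof.
move=> _ _ [n [A [B [mA A0 mB ->]]]] [n' [A' [B' [mA' A0' mB' ->]]]].
exists (n + n')%N, (fun i => if (i < n)%N then A i else A' (i - n)%N),
  (fun i => if (i < n)%N then B i else B' (i - n)%N); split.
- by move=> i; case: ifP.
- by move=> i; case: ifP.
- by move=> i; case: ifP.
apply/seteqP; split => m /=.
  move=> [mAB mAB'] i inn'; case: ifP => [|/negbT]; first exact: mAB.
  by rewrite -leqNgt => ni; apply: mAB'; rewrite ltn_subLR.
move=> h; split=> i ilt.
  by have := h i; rewrite ilt; apply; exact: ltn_addr.
have ni : (n + i < n)%N = false by rewrite ltnNge leq_addr.
by have := h (n + i)%N; rewrite ltn_add2l ni addKn; apply.
Qed.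

Let mbox_set d (T : measurableType d) (p : T -> nat -> \bar R) n A B :
  (forall j, measurable_fun setT (p ^~ j)) -> (forall i, measurable (A i)) ->
  (forall i, measurable (B i)) ->
  measurable [set w | forall i, (i < n)%N -> B i (point_count (p w) (A i))].
Proof.
move=> mp mA mB.
rewrite (_ : [set w | _] = \bigcap_(i in `I_n) ((fun w => point_count (p w) (A i)) @^-1` B i))//.
apply: fin_bigcap_measurable => // i _; rewrite -[X in measurable X]setTI.
exact: mcount.
Qed.

Let boxE d (T : measurableType d) (P : probability T R) (p : T -> nat -> \bar R) n A B :
  (forall j, measurable_fun setT (p ^~ j)) -> (forall i, measurable (A i)) ->
  (forall i, measurable (B i)) ->
  P [set w | forall i, (i < n)%N -> B i (point_count (p w) (A i))] =
  \int[P]_w (box p A B n w * Z p A [::] w)%:E.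
Proof.
move=> mp mA mB.
rewrite -[X in P X](setIT [set w | _]) -integral_indic//; last exact: mbox_set.
apply: eq_integral => w _; rewrite /Z big_nil mulr1 /box indicE; congr (_%:E).
have [|] := boolP (w \in _).
  rewrite inE /= => h; rewrite big1// => i _; rewrite indicE mem_set//.
  exact: h.
rewrite notin_setE /= => nh.
have [i [ilt nB]] : exists i, (i < n)%N /\ ~ B i (point_count (p w) (A i)).
  apply: contrapT => h; apply: nh => i ilt; apply: contrapT => nB.
  by apply: h; exists i.
by rewrite (bigD1 (Ordinal ilt))//= indicE memNset// mul0r.
Qed.

Let mpoint_count d (T : measurableType d) (p : T -> nat -> \bar R) :
  (forall j, measurable_fun setT (p ^~ j)) ->
  measurable_fun setT ((fun w => point_count (p w)) : T -> g_sigma_algebraType finite_cylinders).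
Proof.
move=> mp; apply: (@measurability _ _ _ (g_sigma_algebraType finite_cylinders) _ _
  finite_cylinders) => //.
by move=> _ [_ [n [A [B [mA A0 mB ->]]]] <-]; rewrite setTI; exact: mbox_set.
Qed.

Lemma scs_equivalent_of_functional : scs_equivalent P1 P2 p1 p2.
Proof.
move=> E mE.
have {mE} mE : <<s finite_cylinders >> E.
  move: E mE; apply: smallest_sub; first exact: smallest_sigma_algebra.
  move=> _ [A [B [mA A0 mB ->]]]; apply: sub_sigma_algebra; exists 1%N, (fun=> A), (fun=> B);
    split => //.
  by apply/seteqP; split => m /= h; [move=> i _|exact: (h 0%N)].
pose N1 : {mfun T1 >-> g_sigma_algebraType finite_cylinders} :=
  HB.pack ((fun w => point_count (p1 w)) : T1 -> g_sigma_algebraType finite_cylinders)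
    (isMeasurableFun.Build _ _ _ _ _ (mpoint_count mp1)).
pose N2 : {mfun T2 >-> g_sigma_algebraType finite_cylinders} :=
  HB.pack ((fun w => point_count (p2 w)) : T2 -> g_sigma_algebraType finite_cylinders)
    (isMeasurableFun.Build _ _ _ _ _ (mpoint_count mp2)).
apply: (@measure_unique _ _ (g_sigma_algebraType finite_cylinders) finite_cylinders (fun=> setT)
  _ finite_cylindersI _ _ (distribution P1 N1) (distribution P2 N2)) => //.
(* A cylinder with no constraint is the whole space, which serves as the cover by sets of finite
   measure. *)
- move=> _; exists 0%N, (fun=> set0), (fun=> set0); split=> [i|i []|i|].
  + exact: measurable0.
  + exact: measurable0.
  + by apply/seteqP; split.
- by rewrite bigcup_const.
- move=> _ [n [A [B [mA A0 mB ->]]]]; rewrite /distribution/pushforward/=.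
  transitivity (\int[P1]_w (box p1 A B n w * Z p1 A [::] w)%:E);
    first exact: (@boxE _ _ P1 p1 n A B mp1 mA mB).
  by rewrite eq_box//; apply/esym; exact: (@boxE _ _ P2 p2 n A B mp2 mA mB).
- by move=> _; rewrite (le_lt_trans (probability_le1 _ _))// ltry.
Qed.

End cylinders.

(** * The SINR as a measurable function of the configuration *)

Section sinr_configuration.
Context {R : realType}.

(** The absolute value is nonnegative on all of [\bar R], as the approximation demands, and is the
    identity on powers. Since [f_ n] takes finitely many values, sums over the powers can be read
    from finitely many counts. *)
Let f_ := nnsfun_approx (@measurableT _ (\bar R)) (@abse_measurable R setT).

Let f_cvg (x : \bar R) : 0 <= x -> (f_ n x)%:E @[n --> \oo] --> x.
Proof.
move=> x0; rewrite -[X in _ --> X]gee0_abs//.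
by apply: cvg_nnsfun_approx => // y _; exact: abse_ge0.
Qed.

Let f_nd (x : \bar R) m n : (m <= n)%N -> (f_ m x <= f_ n x)%R.
Proof. by move=> mn; exact/lefP/nd_nnsfun_approx. Qed.

Let f_le n (x : \bar R) : 0 <= x -> (f_ n x)%:E <= x.
Proof.
move=> x0; apply: (@cvge_ge _ _ _ _ _ _ _ _ (f_cvg x0)).
by exists n => // m /= nm; rewrite lee_fin f_nd.
Qed.

Let f0 n : f_ n 0 = 0%R.
Proof. by apply/eqP; rewrite eq_le -lee_fin f_le//=. Qed.

(** The value 0 is removed so that no level set contains 0: only such sets are observed by a
    configuration. *)
Let vals n := [seq c <- fset_set (range (f_ n)) | c != 0%R].

Let mem_vals n x : f_ n x != 0%R -> f_ n x \in vals n.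
Proof. by move=> fx; rewrite mem_filter fx in_fset_set// inE; exists x. Qed.

Let vals_gt0 n c : c \in vals n -> (0 < c)%R.
Proof.
rewrite mem_filter => /andP[c0]; rewrite in_fset_set// inE => -[x _ fx].
by rewrite lt_neqAle eq_sym c0 -fx/=.
Qed.

Let level n c := f_ n @^-1` [set c].

(* [\sum_i f_ n (p i)] for the configuration of the powers [p]. *)
Definition config_sum n (m : set (\bar R) -> \bar R) : \bar R :=
  \sum_(c <- vals n) c%:E * m (level n c).

(* [\max_i f_ n (p i)]; it tends to the power of the serving BS. *)
Definition config_max n (m : set (\bar R) -> \bar R) : \bar R :=
  \big[maxe/0]_(c <- vals n) if m (level n c) == 0 then 0 else c%:E.

Let above k : set (\bar R) := [set x | (k.+1%:R^-1)%:E <= x].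

Definition config_infinite (m : set (\bar R) -> \bar R) : Prop :=
  exists k, m (above k) = +oo.

(* For the configuration of [p], the difference of the two approximations is
   [\sum_(i | i != j0) f_ n (p i)], where [j0] is the serving BS; it is
   meaningful because [f_ n] is finite even at +oo.  If some positive level is
   exceeded infinitely often, the interference is infinite or no power is the
   strongest, and the SINR is 0; otherwise the strongest power is attained. *)
Definition sinr_config (eta : R) (m : set (\bar R) -> \bar R) : \bar R :=
  if `[< config_infinite m >] then 0 else
  let M := limn_esup (config_max ^~ m) in
  M / (limn_esup (fun n => config_sum n m - (f_ n M)%:E) + eta%:E).

Let Conf := g_sigma_algebraType (@configuration_cylinders R).

Let measurable_eval (A : set (\bar R)) : measurable A -> ~ A 0 ->
  measurable_fun [set: Conf] (fun m : Conf => m A).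
Proof.
move=> mA A0 _ B mB; rewrite setTI; apply: sub_sigma_algebra.
by exists A, B.
Qed.

Let measurable_eq d (T : measurableType d) (f : T -> \bar R) x :
  measurable_fun setT f -> measurable_fun setT (fun t => f t == x).
Proof.
move=> mf; apply: (measurable_fun_bool true); rewrite setTI.
rewrite (_ : _ @^-1` _ = f @^-1` [set x]); last first.
  by apply/seteqP; split => t /= /eqP.
by rewrite -[X in measurable X]setTI; apply: mf => //; exact: emeasurable_set1.
Qed.

Let mlevel n c : measurable (level n c).
Proof. exact: measurable_funPTI. Qed.

Let level0 n c : c \in vals n -> ~ level n c 0.
Proof. by move=> /vals_gt0 c0; rewrite /level/= f0 => c00; rewrite c00 ltxx in c0. Qed.

Let measurable_config_sum n : measurable_fun [set: Conf] (config_sum n).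
Proof.
rewrite /config_sum.
elim: (vals n) (@level0 n) => [_|c s IH l0].
  by apply: (eq_measurable_fun (cst 0)) => // m' _; rewrite big_nil.
apply: (eq_measurable_fun (fun m' : Conf => c%:E * m' (level n c) +
    \sum_(c <- s) c%:E * m' (level n c))) => [m' _|]; first by rewrite big_cons.
apply: emeasurable_funD.
  by apply: measurable_funeM; apply: measurable_eval => //; apply: l0; rewrite mem_head.
by apply: IH => c' c's; apply: l0; rewrite inE c's orbT.
Qed.

Let measurable_config_max n : measurable_fun [set: Conf] (config_max n).
Proof.
rewrite /config_max.
elim: (vals n) (@level0 n) => [_|c s IH l0].
  by apply: (eq_measurable_fun (cst 0)) => // m' _; rewrite big_nil.
apply: (eq_measurable_fun (fun m' : Conf =>
    maxe (if m' (level n c) == 0 then 0 else c%:E)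
    (\big[maxe/0]_(c <- s) if m' (level n c) == 0 then 0 else c%:E))) => [m' _|].
  by rewrite big_cons.
apply: measurable_maxe.
  apply: measurable_fun_ifT => //; apply: measurable_eq; apply: measurable_eval => //.
  by apply: l0; rewrite mem_head.
by apply: IH => c' c's; apply: l0; rewrite inE c's orbT.
Qed.

Lemma measurable_sinr_config eta : measurable_fun [set: Conf] (sinr_config eta).
Proof.
apply: measurable_fun_ifT.
- apply: (measurable_fun_bool true); rewrite setTI.
  rewrite (_ : _ @^-1` _ = \bigcup_k ((fun m : Conf => m (above k)) @^-1` [set +oo])); last first.
    apply/seteqP; split => m /=; first by move=> /asboolP[k mk]; exists k.
    by move=> [k _ mk]; apply/asboolP; exists k.
  apply: bigcup_measurable => k _.
  have ma : measurable (above k).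
    have := emeasurable_itv `[(k.+1%:R^-1 : R)%:E, +oo%E].
    by congr measurable; apply/seteqP; split => x /=; rewrite in_itv/= leey andbT.
  have a0 : ~ above k 0 by rewrite /above/= lee_fin leNgt invr_gt0 ltr0n.
  have := measurable_eval ma a0 measurableT (emeasurable_set1 +oo).
  by rewrite setTI.
- exact: measurable_cst.
have mM : measurable_fun [set: Conf] (fun m => limn_esup (config_max ^~ m)).
  exact: measurable_fun_limn_esup.
apply: emeasurable_funM => //; apply: measurable_fun_inve; apply: emeasurable_funD => //.
apply: measurable_fun_limn_esup => n; apply: emeasurable_funB => //.
apply/measurable_EFinP; apply: (measurableT_comp _ mM); exact: measurable_funP.
Qed.

Section sinr_config_point_count.
Variable p : nat -> \bar R.
Hypothesis p0 : forall i, 0 <= p i.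
Let m := point_count p.

(** Each power lies in exactly one level, where it counts for [f_ n (p i)], or in none if this value
    is 0. *)
Let config_sumE n : config_sum n m = \sum_(i <oo) (f_ n (p i))%:E.
Proof.
rewrite /config_sum.
have -> : \sum_(c <- vals n) c%:E * m (level n c) =
    \sum_(c <- vals n) \sum_(i <oo) (c * \1_(level n c) (p i))%:E.
  rewrite big_seq [RHS]big_seq; apply: eq_bigr => c cv.
  by rewrite /m point_countE -nneseriesZl.
rewrite big_seq -nneseries_sum; last first.
  by move=> c i cv; rewrite lee_fin mulr_ge0// (ltW (vals_gt0 cv)).
apply: eq_eseriesr => i _; rewrite -big_seq sumEFin; congr (_%:E).
have [fpi|fpi] := eqVneq (f_ n (p i)) 0%R.
  rewrite fpi big1_seq// => c /andP[_] /vals_gt0 c0.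
  rewrite indicE memNset ?mulr0//= => fc; rewrite -fc fpi ltxx in c0.
  by [].
rewrite (bigD1_seq (f_ n (p i))) ?mem_vals ?filter_uniq ?fset_uniq//=.
rewrite indicE mem_set//= mulr1 big1 ?addr0// => c cne.
rewrite indicE memNset ?mulr0//= => fc.
by rewrite fc eqxx in cne.
Qed.

Let point_count_gt0 A i : A (p i) -> m A != 0.
Proof.
move=> Ai; rewrite /m point_countE gt_eqF//.
apply: (@lt_le_trans _ _ ((\1_A (p i))%:E)).
  by rewrite lte_fin indicE mem_set.
rewrite (@nneseriesD1 _ _ i xpredT)//.
by rewrite leeDl// nneseries_ge0.
Qed.

Let point_count_eq0 A : (forall i, ~ A (p i)) -> m A = 0.
Proof.
by move=> nA; rewrite /m point_countE eseries0// => i _ _; rewrite indicE memNset.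
Qed.

(** Squeeze between [f_ n (p j)] and [p j]: the level of [p j] is occupied unless its value is 0,
    and any occupied level has a value [f_ n (p i) <= p i <= p j]. *)
Let config_max_cvg j : is_serving p j -> config_max n m @[n --> \oo] --> p j.
Proof.
move=> jmax; apply: (squeeze_cvge _ (f_cvg (p0 j)) (cvg_cst (p j))).
apply: nearW => n; apply/andP; split.
  have [->|fpj] := eqVneq (f_ n (p j)) 0%R.
    by apply: bigmax_ge_id.
  rewrite /config_max; apply: (bigmax_sup_seq _ (f_ n (p j))) => //; first exact: mem_vals.
  by rewrite (negbTE (point_count_gt0 (i := j) _)).
apply: bigmax_le => // c _; case: ifPn => // mc.
have [i ic] : exists i, level n c (p i).
  apply: contrapT => h; move/negP: mc; apply; apply/eqP/point_count_eq0 => i ic.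
  by apply: h; exists i.
by rewrite -[c]ic (le_trans (f_le n (p0 i))).
Qed.

(** Choose a level [1 / (k + 1)] reached by some power. Only finitely many powers reach it, so a
    maximum over an initial segment of indices that contains them is global. *)
Let serving_ex : ~ config_infinite m -> exists j, is_serving p j.
Proof.
move=> nU.
have [[i0 pi0]|np] := pselect (exists i, 0 < p i); last first.
  exists 0%N => i; rewrite (le_trans _ (p0 0%N))// leNgt; apply/negP => pi.
  by apply: np; exists i.
have [k kp] : exists k, (k.+1%:R^-1)%:E <= p i0.
  case: (p i0) pi0 => [r|_|//]; last by exists 0%N; rewrite leey.
  rewrite lte_fin => r0; exists (Num.truncn r^-1).
  have r0' : (0 <= r^-1)%R by rewrite invr_ge0 ltW.
  have /andP[_ /ltW rk] := truncn_itv r0'.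
  by rewrite lee_fin invf_ple ?posrE// ltr0n.
have fin : finite_set (p @^-1` above k).
  apply: contrapT => inf; apply: nU; exists k.
  by rewrite /m /point_count /counting asboolF.
have [N HN] : exists N, forall i, above k (p i) -> (i < N)%N.
  exists (\max_(i <- fset_set (p @^-1` above k)) i).+1 => i ai.
  by rewrite ltnS; apply: leq_bigmax_seq => //; rewrite in_fset_set// inE.
have argmax n : exists2 j, (j < n.+1)%N & forall i, (i < n.+1)%N -> p i <= p j.
  elim: n => [|n [j jn jmax]]; first by exists 0%N => // -[].
  have [le|lt] := leP (p n.+1) (p j).
    exists j; first exact: ltnW.
    by move=> i; rewrite ltnS leq_eqVlt => /predU1P[->//|]; exact: jmax.
  exists n.+1 => // i; rewrite ltnS leq_eqVlt => /predU1P[->//|] /jmax h.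
  exact: le_trans h (ltW lt).
have [j jN jmax] := argmax N; exists j => i.
have [ai|ai] := pselect (above k (p i)); first by apply: jmax; apply: ltnW; exact: HN.
have {}ai : p i <= (k.+1%:R^-1)%:E by apply: ltW; rewrite ltNge; apply/negP.
by apply: (le_trans ai); apply: (le_trans kp); apply: jmax; apply: ltnW; exact: HN.
Qed.

(** The term of index [j] is removed before the limit, where it is finite even if [p j = +oo];
    monotone convergence for the counting measure does the rest. *)
Let interference_cvg j :
  config_sum n m - (f_ n (p j))%:E @[n --> \oo] --> \sum_(i <oo | i != j) p i.
Proof.
have -> : (fun n => config_sum n m - (f_ n (p j))%:E) =
    (fun n => \int[counting]_i (if i != j then (f_ n (p i))%:E else 0)).
  apply/funext => n; rewrite config_sumE (@nneseriesD1 _ _ j xpredT)//; last first.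
    by move=> k _; rewrite lee_fin.
  rewrite addeAC subee// add0e ge0_integral_count; last first.
    by move=> k; case: ifP => // _; rewrite lee_fin.
  by rewrite eseries_mkcond.
rewrite eseries_mkcond -ge0_integral_count; last by move=> k; case: ifP.
rewrite (_ : \int[_]_i _ = \int[counting]_i limn (fun n => if i != j then (f_ n (p i))%:E else
  0)).
  apply: cvg_monotone_convergence => //.
  - by move=> n i _; case: ifP => // _; rewrite lee_fin.
  - by move=> i _ a b ab; case: ifP => // _; rewrite lee_fin f_nd.
apply: eq_integral => i _; apply/esym/cvg_lim => //.
by case: ifP => _; [exact: f_cvg|exact: cvg_cst].
Qed.

Let interference_infinite j : config_infinite m -> \sum_(i <oo | i != j) p i = +oo.
Proof.
move=> [k mk]; pose e : R := (k.+1%:R^-1)%R.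
have e0 : (0 < e)%R by rewrite invr_gt0.
pose a i : \bar R := (e * \1_(above k) (p i))%:E.
have a0 i : 0 <= a i by rewrite lee_fin mulr_ge0// ltW.
have : \sum_(i <oo) a i = +oo.
  rewrite (_ : \sum_(i <oo) a i = e%:E * m (above k)); last first.
    by rewrite /m point_countE -nneseriesZl.
  by rewrite mk gt0_muley.
rewrite (@nneseriesD1 _ _ j xpredT)// => aoo.
(* The term of index [j] is finite, so the remaining series is infinite. *)
have {}aoo : \sum_(i <oo | i != j) a i = +oo.
  by move: aoo; rewrite /a/=; case: (\sum_(i <oo | _) _).
apply/eqP; rewrite -leye_eq -aoo; apply: lee_nneseries => // i _.
rewrite /a indicE; have [|_] := boolP (p i \in above k); last by rewrite mulr0.
by rewrite inE mulr1.
Qed.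

Lemma sinr_configE eta : sinr eta p = sinr_config eta m.
Proof.
rewrite /sinr /sinr_config.
have [U|nU] := pselect (config_infinite m).
  rewrite (asboolT U); case: ifP => // _.
  by rewrite interference_infinite//= invey mule0.
rewrite (asboolF nU) (asboolT (serving_ex nU)).
have /getPex := serving_ex nU; set j := get _ => jmax.
have -> : limn_esup (config_max ^~ m) = p j by exact: (cvg_limn_einf_sup (config_max_cvg jmax)).2.
by rewrite (cvg_limn_einf_sup (@interference_cvg j)).2.
Qed.

End sinr_config_point_count.
End sinr_configuration.

Theorem theorem2 (R : realType)
    (dS : measure_display) (S : measurableType dS) (Q : probability S R)
    (K Psi : {RV Q >-> R})
    (K_ge0 : forall s, (0 <= K s)%R) (Psi_ge0 : forall s, (0 <= Psi s)%R)
    (lambda : R -> R) (lambda_density : bs_density lambda)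
    (lambda_bar_fin : forall r : R, (0 <= r)%R ->
       lambda_bar Q K Psi lambda r < +oo)
    (d1 : measure_display) (T1 : measurableType d1) (P1 : probability T1 R)
    (D1 : nat -> T1 -> \bar R) (K1 Psi1 : nat -> T1 -> R)
    (scs1 : is_scs P1 Q lambda K Psi D1 K1 Psi1)
    (d2 : measure_display) (T2 : measurableType d2) (P2 : probability T2 R)
    (D2 : nat -> T2 -> \bar R) (K2 Psi2 : nat -> T2 -> R)
    (scs2 : is_scs P2 Q (fun r => fine (lambda_bar Q K Psi lambda r))
              (cst 1%R) (cst 1%R) D2 K2 Psi2) :
  scs_equivalent P1 P2 (received_power D1 K1 Psi1) (received_power D2 K2 Psi2)
  /\ (forall eta : R, (0 <= eta)%R ->
       same_distribution P1 P2
         (fun w => sinr eta (received_power D1 K1 Psi1 w))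
         (fun w => sinr eta (received_power D2 K2 Psi2 w))).
Proof.
have [mlambda lambda0 _] := lambda_density.
have mK : measurable_fun setT K by [].
have mPsi : measurable_fun setT Psi by [].
have mlb := measurable_lambda_bar Q mK mPsi K_ge0 Psi_ge0 mlambda lambda0.
have lb0 r : (0 <= r)%R -> (0 <= fine (lambda_bar Q K Psi lambda r))%R.
  by move=> r0; apply: fine_ge0; exact: lambda_bar_ge0.
have mp1 j := measurable_received_power scs1 j.
have mp2 j := measurable_received_power scs2 j.
have eqv : scs_equivalent P1 P2 (received_power D1 K1 Psi1) (received_power D2 K2 Psi2).
  apply: scs_equivalent_of_functional => // phi mphi phi01 phi0.
  (* The common limit is written with [lambda_bar], the form to which the second system leads once
     its constant marks are integrated out. *)
  exists (expeR (- \int[lebesgue_measure]_(r in `[0%R, +oo[)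
      ((1 - phi (1 / r%:E)%E) * fine (lambda_bar Q K Psi lambda r))%:E)); split.
    by rewrite -integral_lambda_bar//; exact: (received_power_functional mK mPsi scs1).
  have := received_power_functional (measurable_cst _) (measurable_cst _) scs2 mlb lb0 mphi
    phi01 phi0.
  congr (_ --> expeR (- _)); apply: eq_integral => r _; congr ((1 - _) * _)%:E.
  under eq_integral do rewrite /= mulr1.
  by rewrite integral_cst//= probability_setT mule1.
split=> // eta eta0 B mB.
(* The event on the SINR is a measurable event on the configuration, to which the equivalence
   applies. *)
rewrite (_ : _ @^-1` B = [set w | (sinr_config eta @^-1` B) (point_count (received_power D1 K1
  Psi1 w))]).
  rewrite eqv.
    congr (P2 _); apply/seteqP; split => w /=.
      by rewrite -sinr_configE// => j; exact: received_power_ge0 scs2 w j.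
    by rewrite sinr_configE// => j; exact: received_power_ge0 scs2 w j.
  by have := measurable_sinr_config eta measurableT mB; rewrite setTI.
apply/seteqP; split => w /=.
  by rewrite sinr_configE// => j; exact: received_power_ge0 scs1 w j.
by rewrite -sinr_configE// => j; exact: received_power_ge0 scs1 w j.
Qed.
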